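(* Let $p\ge 1$. A sequence of metric measure spaces $(X_n,d_n,\mu_n)_{n\in\mathbb{N}}$ strongly measured-Gromov converges to a metric measure space $(X_\infty,d_\infty,\mu_\infty)$ if and only if $$\mathbf{PL}_p\big((X_n,d_n,\mu_n),(X_\infty,d_\infty,\mu_\infty)\big)\to 0\quad\text{as }n\to\infty.$$
   Context: For a complete separable metric space $X$, $\mathscr{M}(X)$ denotes the set of finite nonnegative Borel measures on $X$. For a superlinear convex lower semicontinuous $F:[0,\infty)\to[0,\infty]$ with $F(1)=0$ (superlinear: $F(s)/s\to\infty$ as $s\to\infty$), the $F$-divergence is $D_F(\gamma\|\mu):=\int_X F(\frac{d\gamma}{d\mu})\,d\mu$ if $\gamma\ll\mu$ and $+\infty$ otherwise. The Entropy-Transport cost induced by $F$ and a lower semicontinuous cost $c:X\times X\to[0,\infty]$ is $$\mathrm{ET}(\mu_1,\mu_2):=\inf_{\gamma\in\mathscr{M}(X\times X)}\Big\{D_F(\gamma_1\|\mu_1)+D_F(\gamma_2\|\mu_2)+\int_{X\times X} c\,d\gamma\Big\},$$ where $\gamma_i=(\pi^i)_\sharp\gamma$ are the marginals of $\gamma$. Set $U_1(s):=s\log s-s+1$ and, for $p>1$, $U_p(s):=\frac{s^p-p(s-1)-1}{p(p-1)}$. A metric measure space is a triple $(X,d,\mu)$ with $(X,d)$ a complete separable metric space and $\mu\in\mathscr{M}(X)$; $\mathsf{supp}(\mu)$ is the support of $\mu$. Metric measure spaces are identified when isomorphic, i.e. when there is an isometry $\psi:\mathsf{supp}(\mu_1)\to\mathsf{supp}(\mu_2)$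 with $\psi_\sharp\mu_1=\mu_2$. Let $\mathsf{D}_{p,n}:=\mathrm{ET}^{1/2}$ on $\mathscr{M}(X)$, with $\mathrm{ET}$ induced by $F=U_p$ and $c=n\,d$, and let $\mathbf{D}_{p,n}\big((X_1,d_1,\mu_1),(X_2,d_2,\mu_2)\big):=\inf\mathsf{D}_{p,n}(\psi^1_\sharp\mu_1,\psi^2_\sharp\mu_2)$, the infimum over all complete separable metric spaces $(\hat X,\hat d)$ and isometric embeddings $\psi^i:\mathsf{supp}(\mu_i)\to\hat X$, $i=1,2$. This is nondecreasing in $n$, and one defines $$\mathbf{PL}_p\big((X_1,d_1,\mu_1),(X_2,d_2,\mu_2)\big):=\lim_{n\to\infty}\mathbf{D}_{p,n}\big((X_1,d_1,\mu_1),(X_2,d_2,\mu_2)\big).$$ Strong measured-Gromov convergence: $(X_n,d_n,\mu_n)_{n\in\mathbb{N}}$ strongly measured-Gromov converges to $(X_\infty,d_\infty,\mu_\infty)$ if there exist a complete separable metric space $(X,d)$ and isometric embeddings $\iota_n:X_n\to X$, $n\in\mathbb{N}\cup\{\infty\}$, such that $(\iota_n)_\sharp\mu_n\to(\iota_\infty)_\sharp\mu_\infty$ in $\mathscr{M}(X)$ with respect to the total variation topology. *)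

(* Defs.v *)
From HB Require Import structures.
From mathcomp Require Import all_boot all_order all_algebra.
From mathcomp Require Import all_classical all_reals all_analysis.

Set Implicit Arguments.
Unset Strict Implicit.
Unset Printing Implicit Defensive.

Import Order.TTheory GRing.Theory Num.Theory.
Import numFieldNormedType.Exports.

Local Open Scope classical_set_scope.
Local Open Scope ring_scope.
Local Open Scope ereal_scope.

HB.mixin Record isSeparable T & Topological T := {
  separable : exists2 S : set T, countable S & dense S
}.

(* [Complete] includes [Pointed], hence so does this structure: as usual,
   metric spaces are nonempty. Supports of measures may still be empty. *)
#[short(type="polishMetricType")]
HB.structure Definition PolishMetric (R : realType) :=
  {T of Metric R T & Complete T & isSeparable T}.

Section subspace_metric.
Context {R : realType} {X : metricType R} (A : set X).

Let dist (x y : A) : R := mdist (set_val x) (set_val y).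

Let dist_ge0 x y : (0 <= dist x y)%R.
Proof. exact: mdist_ge0. Qed.

Let dist_positivity x y : dist x y = 0%R -> x = y.
Proof. by move=> /mdist_positivity xy; apply: val_inj. Qed.

Let ballEdist (x : A) (d : R) : ball x d = [set y | (dist x y < d)%R].
Proof.
have -> : ball x d = set_val @^-1` (ball (set_val x) d) by [].
by rewrite ballEmdist.
Qed.

HB.instance Definition _ := @PseudoMetric_isMetric.Build R (set_type A)
  dist dist_ge0 dist_positivity ballEdist.

End subspace_metric.

Record isometric_embedding (R : realType) (X Y : metricType R) :=
  IsometricEmbedding {
    embedding_fun :> X -> Y ;
    embedding_isometry :
      forall x y, mdist (embedding_fun x) (embedding_fun y) = mdist x y }.

Lemma embedding_continuous (R : realType) (X Y : metricType R)
  (f : isometric_embedding X Y) : continuous f.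
Proof.
move=> x; apply/metricType_numDomainType.cvgrPdist_lt => e e0.
apply/metricType_numDomainType.nbhs_mdistP.
by exists e => // y /=; rewrite embedding_isometry.
Qed.

(* Triggers the inference of the product [ptopologicalType]. *)
HB.instance Definition _ (S T : ptopologicalType) := Pointed.on (S * T)%type.

Definition borel (T : ptopologicalType) := g_sigma_algebraType (@open T).

HB.instance Definition _ (T : ptopologicalType) :=
  Measurable.copy (borel T) (g_sigma_algebraType (@open T)).

Notation borel_measure R T := {finite_measure set (borel T) -> \bar R}.

Lemma continuous_borel (S T : ptopologicalType) (f : S -> T) :
  continuous f -> measurable_fun [set: borel S] (f : borel S -> borel T).
Proof.
move=> /continuousP cf.
apply: (@measurability _ _ (borel S) (borel T) setT f (@open T)) => //.
move=> _ [B oB <-]; rewrite setTI; apply: sub_sigma_algebra; exact: cf.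
Qed.

Lemma fst_continuous (S T : topologicalType) : continuous (@fst S T).
Proof. by move=> x; exact: cvg_fst. Qed.

Lemma snd_continuous (S T : topologicalType) : continuous (@snd S T).
Proof. by move=> x; exact: cvg_snd. Qed.

(* The continuity proof is an argument so that the finite measure structure on
   [cpushforward cf mu] can be inferred. *)
Definition cpushforward {R : realType} {S T : ptopologicalType} {f : S -> T}
    (cf : continuous f) (mu : borel_measure R S) : set (borel T) -> \bar R :=
  pushforward mu (f : borel S -> borel T).

Section continuous_pushforward.
Context {R : realType} {S T : ptopologicalType} {f : S -> T}.
Context (cf : continuous f) (mu : borel_measure R S).

Local Notation cpushforward := (cpushforward cf mu).

Let mpre (A : set (borel T)) :
  measurable A -> measurable ((f @^-1` A) : set (borel S)).
Proof.
move=> mA; rewrite -[X in measurable X]setTI.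
exact: (continuous_borel cf measurableT mA).
Qed.

Let cpushforward0 : cpushforward set0 = 0.
Proof. by rewrite /cpushforward /pushforward preimage_set0 measure0. Qed.

Let cpushforward_ge0 A : 0 <= cpushforward A.
Proof. by rewrite /cpushforward /pushforward; exact: measure_ge0. Qed.

Let cpushforward_sigma_additive : semi_sigma_additive cpushforward.
Proof.
move=> F mF tF mUF; rewrite /cpushforward /pushforward preimage_bigcup.
apply: measure_semi_sigma_additive.
- by move=> n; exact: mpre.
- apply/trivIsetP => /= i j _ _ ij; rewrite -preimage_setI.
  by move/trivIsetP : tF => /(_ _ _ _ _ ij) ->//; rewrite preimage_set0.
- by rewrite -preimage_bigcup; exact: mpre.
Qed.

HB.instance Definition _ := isMeasure.Build _ _ _ cpushforward
  cpushforward0 cpushforward_ge0 cpushforward_sigma_additive.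

Let cpushforward_fin : fin_num_fun cpushforward.
Proof. by move=> A mA; apply: fin_num_measure; exact: mpre. Qed.

HB.instance Definition _ :=
  Measure_isFinite.Build _ _ _ cpushforward cpushforward_fin.

End continuous_pushforward.

Section support.
Context {R : realType} {T : ptopologicalType} (mu : borel_measure R T).

Definition support : set T := [set x | forall U, open U -> U x -> 0 < mu U].

Lemma closed_support : closed support.
Proof.
move=> x clx U oU Ux.
have [y [sy Uy]] := clx U (open_nbhs_nbhs (conj oU Ux)).
exact: sy.
Qed.

Lemma measurable_support : measurable (support : set (borel T)).
Proof.
rewrite -[support]setCK; apply: measurableC; apply: sub_sigma_algebra.
by rewrite /= openC; exact: closed_support.
Qed.

End support.

Section support_pushforward.
Context {R : realType} {X Y : polishMetricType R} (mu : borel_measure R X).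
Context (psi : isometric_embedding (support mu) Y).

(* [psi @^-1` B] is a subset of the subspace [support mu]; [set_val] sends it
   to the corresponding Borel subset of [X]. *)
Definition spreimage (B : set (borel Y)) : set (borel X) :=
  set_val @` (psi @^-1` B).

Definition spushforward : set (borel Y) -> \bar R := mu \o spreimage.

Lemma spreimage_bigcup (F : (set (borel Y))^nat) :
  spreimage (\bigcup_n F n) = \bigcup_n spreimage (F n).
Proof. by rewrite /spreimage preimage_bigcup image_bigcup. Qed.

Lemma spreimageC (B : set (borel Y)) :
  spreimage (~` B) = support mu `\` spreimage B.
Proof.
apply/seteqP; split => [_ [x Bx <-]|x [sx nBx]].
  split; first exact: set_valP.
  by move=> [y By] /val_inj yx; apply: Bx; rewrite -yx.
exists (exist _ x (mem_set sx)) => // Bx; apply: nBx.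
by exists (exist _ x (mem_set sx)).
Qed.

Lemma open_measurable_spreimage (B : set Y) :
  open B -> measurable (spreimage B).
Proof.
move=> oB; have [V oV VE] : open (psi @^-1` B).
  by have /continuousP := @embedding_continuous _ _ _ psi; exact.
have -> : spreimage B = (V : set (borel X)) `&` support mu.
  rewrite /spreimage -VE; apply/seteqP; split => [_ [x Vx <-]|x [Vx sx]].
    by split => //; exact: set_valP.
  by exists (exist _ x (mem_set sx)).
apply: measurableI; last exact: measurable_support.
exact: sub_sigma_algebra.
Qed.

Lemma measurable_spreimage (B : set (borel Y)) :
  measurable B -> measurable (spreimage B).
Proof.
pose G : set (set (borel Y)) := [set B | measurable (spreimage B)].
suff : <<s @open Y >> `<=` G by exact.
apply: smallest_sub => [|A oA]; last exact: open_measurable_spreimage.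
split => /= [|A GA|F GF].
- by rewrite /G /= /spreimage preimage_set0 image_set0.
- rewrite setTD /G /= spreimageC.
  by apply: measurableD => //; exact: measurable_support.
- by rewrite /G /= spreimage_bigcup; apply: bigcupT_measurable => n; exact: GF.
Qed.

Let spushforward0 : spushforward set0 = 0.
Proof.
by rewrite /spushforward /= /spreimage preimage_set0 image_set0 measure0.
Qed.

Let spushforward_ge0 A : 0 <= spushforward A.
Proof. by rewrite /spushforward; exact: measure_ge0. Qed.

Let spushforward_sigma_additive : semi_sigma_additive spushforward.
Proof.
move=> F mF tF mUF; rewrite /spushforward /= spreimage_bigcup.
apply: measure_semi_sigma_additive.
- by move=> n; exact: measurable_spreimage.
- move=> i j _ _ [_ [[x Fix <-] [y Fjy /val_inj yx]]]; apply: tF => //.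
  by exists (psi x); split => //; rewrite -yx.
- by rewrite -spreimage_bigcup; exact: measurable_spreimage.
Qed.

HB.instance Definition _ := isMeasure.Build _ _ _ spushforward
  spushforward0 spushforward_ge0 spushforward_sigma_additive.

Let spushforward_fin : fin_num_fun spushforward.
Proof. by move=> A mA; apply: fin_num_measure; exact: measurable_spreimage. Qed.

HB.instance Definition _ :=
  Measure_isFinite.Build _ _ _ spushforward spushforward_fin.

End support_pushforward.

Section entropy_transport.
Context {R : realType}.

(* [F] is only evaluated on [0, +oo[ since the Radon-Nikodym derivative is
   finite, and nonnegative mu-almost everywhere. *)
Definition divergence (T : ptopologicalType) (F : R -> \bar R)
    (gamma mu : borel_measure R T) : \bar R :=
  if `[< gamma `<< mu >] then
    \int[mu]_x F (fine (Radon_Nikodym (charge_of_finite_measure gamma) mu x))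
  else +oo.

Definition entropy_transport (T : ptopologicalType) (F : R -> \bar R)
    (c : T * T -> \bar R) (mu1 mu2 : borel_measure R T) : \bar R :=
  ereal_inf [set divergence F (cpushforward (@fst_continuous T T) gamma) mu1
               + divergence F (cpushforward (@snd_continuous T T) gamma) mu2
               + \int[gamma]_z c z
            | gamma in [set: borel_measure R (T * T)%type]].

(* [ln 0 = 0], so that [power_entropy 1 0 = 1]. *)
Definition power_entropy (p s : R) : R :=
  if p == 1%R then (s * ln s - s + 1)%R
  else ((s `^ p - p * (s - 1) - 1) / (p * (p - 1)))%R.

Definition ET_dist (p : R) (n : nat) (X : polishMetricType R)
    (mu1 mu2 : borel_measure R X) : \bar R :=
  sqrte (entropy_transport (fun s => (power_entropy p s)%:E)
    (fun z => (n%:R * mdist z.1 z.2)%:E) mu1 mu2).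

End entropy_transport.

Record mmspace (R : realType) := MMSpace {
  mm_space :> polishMetricType R ;
  mm_measure : borel_measure R mm_space
}.

Section mmspaces.
Context {R : realType}.

Definition mm_ET_dist (p : R) (n : nat) (X1 X2 : mmspace R) : \bar R :=
  ereal_inf [set v | exists (Y : polishMetricType R)
    (psi1 : isometric_embedding (support (mm_measure X1)) Y)
    (psi2 : isometric_embedding (support (mm_measure X2)) Y),
    v = ET_dist p n (spushforward psi1) (spushforward psi2)].

Definition PL (p : R) (X1 X2 : mmspace R) : \bar R :=
  limn (fun n => mm_ET_dist p n X1 X2).

End mmspaces.

Section strong_convergence.
Context {R : realType}.

(* The value does not depend on the Hahn decomposition which is chosen. *)
Definition total_variation d (T : measurableType d)
    (nu : {charge set T -> \bar R}) : \bar R :=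
  let P := cid (Hahn_decomposition nu) in
  charge_variation (projT2 (cid (projT2 P))) [set: T].

Definition TV_dist d (T : measurableType d)
    (mu nu : {finite_measure set T -> \bar R}) : \bar R :=
  total_variation (cadd (charge_of_finite_measure mu)
                        (copp (charge_of_finite_measure nu))).

Definition strong_mG_cvg (X : nat -> mmspace R) (Xoo : mmspace R) : Prop :=
  exists (Y : polishMetricType R)
    (iota : forall n, isometric_embedding (X n) Y)
    (iotaoo : isometric_embedding Xoo Y),
    TV_dist (cpushforward (@embedding_continuous _ _ _ (iota n)) (mm_measure (X n)))
       (cpushforward (@embedding_continuous _ _ _ iotaoo) (mm_measure Xoo))
      @[n --> \oo] --> 0.

End strong_convergence.

(* Main.v *)
Require Import Defs.
From HB Require Import structures.
From mathcomp Require Import all_boot all_order all_algebra.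
From mathcomp Require Import all_classical all_reals all_analysis.
From mathcomp Require Import measurable_realfun.
From mathcomp Require Import ring lra.

(* If the measures are close in total variation in a common space, transporting
   nothing, along the diagonal coupling of their minimum, bounds every ET cost by
   their distance, because U_p s <= 1 - s on [0, 1].

   Conversely, PL_p(X, Xoo) < r provides for every k a plan of cost at most r^2
   for the distance k d. Seen as set functions on X x Xoo, these plans have an
   ultralimit, which is only finitely additive, but whose marginals satisfy
   U_p'(a) (nu A - a mu A) <= r^2 for all a > 0 (tangent lines of U_p): as U_p' is
   unbounded, its null sets are stable under countable unions. As the transport
   distances tend to 0, the limit preserves distances between the points it
   couples; completeness then shows that it is carried by the graph of an isometry
   between subsets of X and Xoo. Gluing all the X_n to Xoo along these graphs
   gives a space where both marginals of each limit coupling agree, and are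
   close to the images of mu_n and mu_oo by the inequality above. This
   replaces Prokhorov's theorem and the compactness of the transport distances. *)

Set Implicit Arguments.
Unset Strict Implicit.
Unset Printing Implicit Defensive.

Import Order.TTheory GRing.Theory Num.Theory.
Import numFieldNormedType.Exports.

Local Open Scope classical_set_scope.
Local Open Scope ring_scope.

(** * Polish completion of a separable pseudo-metric *)

(** The obstacle is that the plan of level [k] lives on a space which itself depends on [k], with no
    tightness at hand. What can be compared for different [k] are the masses that the plans give to
    rectangles of Borel sets of X and Xoo. So the proof keeps only facts about these masses that
    survive a limit. Additivity and the tangent inequalities are affine in the masses, so they pass
    to the limit without any semicontinuity of the divergence. The cost enters only through
    Chebyshev's inequality: a rectangle of mass b contains a pair at distance at most r^2 / (k b),
    which vanishes as k grows with r fixed. The tangents serve twice. At large a they make the limit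
    absolutely continuous with respect to both measures. At 1 + h and 1 - h their slopes have
    opposite signs, which squeezes the common marginal of the limit between multiples of each
    measure close to 1, up to an error controlled by r^2. *)

Record separable_pdist (R : realType) (Z : Type) := SeparablePdist {
  pdist :> Z -> Z -> R ;
  pdistxx : forall x, pdist x x = 0 ;
  pdist_sym : forall x y, pdist x y = pdist y x ;
  pdist_triangle : forall y x z, pdist x z <= pdist x y + pdist y z ;
  pdist_separable : exists s : nat -> Z,
    forall x (e : R), 0 < e -> exists n, pdist x (s n) < e }.

(* The completion of the metric quotient of [Z], as the closure in the sup
   distance of the image of [z |-> d z] (Kuratowski's embedding). *)
Record completion (R : realType) (Z : Type) (d : separable_pdist R Z) :=
  Completion {
    kuratowski :> Z -> R ;
    kuratowski_approx : forall e : R, 0 < e ->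
      exists z, forall i, `|kuratowski i - d z i| <= e }.

HB.instance Definition _ R Z (d : separable_pdist R Z) :=
  gen_eqMixin (completion d).
HB.instance Definition _ R Z (d : separable_pdist R Z) :=
  gen_choiceMixin (completion d).

Section completion.
Context {R : realType} {Z : Type} (d : separable_pdist R Z).
Implicit Types g h : completion d.

Lemma completion_ext g h : (forall i, g i = h i) -> g = h.
Proof.
case: g h => [g gP] [h hP] /= /funext gh; move: gP hP.
by rewrite gh => gP hP; rewrite (Prop_irrelevance gP hP).
Qed.

Let cdist g h : R := sup (range (fun i => `|g i - h i|)).

Let cdist_has_sup g h : has_sup (range (fun i => `|g i - h i|)).
Proof.
have [z gz] := kuratowski_approx g (@ltr01 R).
have [w hw] := kuratowski_approx h (@ltr01 R).
split; first by exists `|g z - h z|, z.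
(* [g] and [h] are within 1 of [d z] and [d w], which differ by at most [d z w]. *)
exists (2 + d z w) => _ [i _ <-].
have := gz i; have := hw i; rewrite !ler_norml => /andP[? ?] /andP[? ?].
have := pdist_triangle d z w i; have := pdist_triangle d w z i.
by rewrite (pdist_sym d w z) => ? ?; apply/andP; split; lra.
Qed.

Let cdist_ub g h i : `|g i - h i| <= cdist g h.
Proof. by apply: (ub_le_sup (cdist_has_sup g h).2); exists i. Qed.

Let cdist_le g h (c : R) : (forall i, `|g i - h i| <= c) -> cdist g h <= c.
Proof.
move=> gh; apply: ge_sup; first exact: (cdist_has_sup g h).1.
by move=> _ [i _ <-].
Qed.

Let cdist_pt g : exists z : Z, True.
Proof. by have [z _] := kuratowski_approx g (@ltr01 R); exists z. Qed.

Let cdist_ge0 g h : 0 <= cdist g h.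
Proof. by have [z _] := cdist_pt g; apply: le_trans (cdist_ub g h z). Qed.

Let cdistxx g : cdist g g = 0.
Proof.
apply/eqP; rewrite eq_le cdist_ge0 andbT.
by apply: cdist_le => i; rewrite subrr normr0.
Qed.

Let cdist_positivity g h : cdist g h = 0 -> g = h.
Proof.
move=> gh0; apply: completion_ext => i; apply/eqP; rewrite -subr_eq0 -normr_le0.
by rewrite -gh0 cdist_ub.
Qed.

Let cdist_sym g h : cdist g h = cdist h g.
Proof.
rewrite /cdist; suff -> : (fun i => `|g i - h i|) = (fun i => `|h i - g i|) by [].
by apply/funext => i; rewrite distrC.
Qed.

Let cdist_triangle h g k : cdist g k <= cdist g h + cdist h k.
Proof.
apply: cdist_le => i; apply: le_trans (ler_distD (h i) _ _) _.
by rewrite lerD ?cdist_ub.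
Qed.

HB.instance Definition _ := @isMetric.Build R (completion d)
  cdist cdistxx cdist_positivity cdist_sym cdist_triangle.

Lemma mdist_completion_ub g h i : `|g i - h i| <= mdist g h.
Proof. exact: cdist_ub. Qed.

Lemma mdist_completion_le g h (c : R) :
  (forall i, `|g i - h i| <= c) -> mdist g h <= c.
Proof. exact: cdist_le. Qed.

Let embed_approx (z : Z) (e : R) : 0 < e ->
  exists w, forall i, `|d z i - d w i| <= e.
Proof. by move=> e0; exists z => i; rewrite subrr normr0 ltW. Qed.

Definition completion_embed (z : Z) : completion d :=
  Completion (@embed_approx z).

Lemma mdist_completion_embed z w :
  mdist (completion_embed z) (completion_embed w) = d z w.
Proof.
apply/eqP; rewrite eq_le; apply/andP; split; last first.
  apply: le_trans (mdist_completion_ub _ _ w) => /=.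
  by rewrite pdistxx subr0 ler_norm.
apply: mdist_completion_le => i /=.
rewrite ler_norml; apply/andP; split.
  by have := pdist_triangle d z w i; rewrite (pdist_sym d w z); lra.
by have := pdist_triangle d w z i; lra.
Qed.

Lemma mdist_completion_embed_approx g (e : R) : 0 < e ->
  exists z, mdist g (completion_embed z) <= e.
Proof.
move=> e0; have [z gz] := kuratowski_approx g e0; exists z.
exact: mdist_completion_le.
Qed.

Let completion_pt : completion d :=
  completion_embed (sval (cid (pdist_separable d)) 0%N).

HB.instance Definition _ := isPointed.Build (completion d) completion_pt.

Let completion_complete (F : set_system (completion d)) :
  ProperFilter F -> cauchy F -> cvg F.
Proof.
move=> FF /(@cauchyP R (completion d)) cF0.
have cF (e : R) : 0 < e -> exists x : completion d, F [set g | mdist x g < e].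
  by move=> /cF0 [x Fx]; exists x; rewrite -ballEmdist.
have ccF i : cvg ((fun g : completion d => g i) @ F).
  apply: cauchy_cvg; apply: cauchy_exP => e e0.
  have [x Fx] := cF e e0; exists (x i).
  suff : F [set g : completion d | ball (x i) e (g i)] by [].
  apply: (filterS _ Fx) => g /= xg.
  by rewrite /ball /=; apply: le_lt_trans xg; exact: mdist_completion_ub.
(* The limit is taken pointwise. The bound [lx] is uniform in [i], so that [l] is again a uniform
   limit of functions [d z], and [F] converges to it in the sup distance. *)
pose l i := lim ((fun g : completion d => g i) @ F).
have lx (e : R) (x : completion d) :
    F [set g | mdist x g < e] -> forall i, `|l i - x i| <= e.
  move=> Fx i; rewrite distrC.
  have cl : (fun g : completion d => `|x i - g i|) @ F --> `|x i - l i|.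
    by apply: cvg_norm; apply: cvgB; [exact: cvg_cst|exact: ccF].
  rewrite -(cvg_lim _ cl)//; apply: limr_le.
    by apply/cvg_ex; exists `|x i - l i|.
  suff : F [set g : completion d | `|x i - g i| <= e] by [].
  apply: (filterS _ Fx) => g /= xg.
  exact: le_trans (mdist_completion_ub _ _ i) (ltW xg).
have lP (e : R) : 0 < e -> exists z, forall i, `|l i - d z i| <= e.
  move=> e0; have e20 : 0 < e / 2 by rewrite divr_gt0.
  have [x /lx Fx] := cF _ e20; have [z xz] := kuratowski_approx x e20.
  exists z => i; apply: le_trans (ler_distD (x i) _ _) _.
  by rewrite [leRHS]splitr lerD.
apply/cvg_ex; exists (Completion lP).
apply/metricType_numDomainType.fcvgrPdist_lt => e e0.
have e30 : 0 < e / 3 by rewrite divr_gt0.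
have [x Fx] := cF _ e30; have xl := lx _ _ Fx.
suff : F [set g | mdist (Completion lP) g < e] by [].
apply: (filterS _ Fx) => g /= xg.
apply: le_lt_trans (metric_triangle _ x _) _.
have : mdist (Completion lP) x <= e / 3 by exact: mdist_completion_le.
lra.
Qed.

HB.instance Definition _ :=
  Uniform_isComplete.Build (completion d) completion_complete.

Let completion_separable : exists2 S : set (completion d),
  countable S & dense S.
Proof.
have [s sP] := pdist_separable d.
exists (range (completion_embed \o s)).
  exact: card_image_le.
move=> O [g Og] oO.
have /metricType_numDomainType.nbhs_mdistP [e /= e0 eO] := open_nbhs_nbhs (conj oO Og).
have e30 : 0 < e / 3 by rewrite divr_gt0.
have [z gz] := mdist_completion_embed_approx g e30.
have [n zn] := sP z _ e30.
exists (completion_embed (s n)); split; last by exists n.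
apply: eO => /=; apply: le_lt_trans (metric_triangle _ (completion_embed z) _) _.
rewrite mdist_completion_embed; lra.
Qed.

HB.instance Definition _ :=
  isSeparable.Build (completion d) completion_separable.

End completion.


(** * Gluing a sequence of metric spaces along isometric subsets of a common one *)

Lemma dense_sequence (R : realType) (X : polishMetricType R) :
  exists s : nat -> X, forall x (e : R), 0 < e -> exists n, mdist x (s n) < e.
Proof.
have [S /countable_injP [f finj] dS] := @separable R X.
pose s n := xget point [set x | S x /\ f x = n].
exists s => x e e0.
have ox : open (ball x e)^° by exact: open_interior.
have [] := dS _ _ ox.
  by exists x; apply: nbhs_singleton; apply: nbhs_interior; exact: nbhsx_ballx.
move=> y [/interior_subset]; rewrite ballEmdist /= => xy Sy.
exists (f y); suff -> : s (f y) = y by [].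
rewrite /s; case: xgetP => [z -> [Sz fzy]|/(_ y)]; last by case.
by apply: finj; rewrite ?inE.
Qed.

Lemma mdist_lipschitz (R : realType) (X : metricType R) (a x y : X) :
  `|mdist a x - mdist a y| <= mdist x y.
Proof.
rewrite ler_norml; apply/andP; split.
  by have := metric_triangle a x y; lra.
by have := metric_triangle a y x; rewrite (metric_sym y x); lra.
Qed.

(** [P] is the graph of a partial function: the Lipschitz hypothesis with a = a' makes it
    single-valued. The extension is the infimum of the cones v + mdist a x, finite because the
    domain is nonempty. *)
Lemma mcshane_extension (R : realType) (X : metricType R) (P : X -> R -> Prop) :
  (exists a v, P a v) ->
  (forall a v a' v', P a v -> P a' v' -> `|v - v'| <= mdist a a') ->
  exists2 f : X -> R, (forall x y, `|f x - f y| <= mdist x y) &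
    (forall a v, P a v -> f a = v).
Proof.
move=> [a0 [v0 P0]] Plip.
pose E x := [set r | exists a v, P a v /\ r = v + mdist a x].
have E0 x : E x !=set0 by exists (v0 + mdist a0 x), a0, v0.
have Elb x : has_lbound (E x).
  exists (v0 - mdist a0 x) => _ [a [v [Pav ->]]].
  have := Plip _ _ _ _ P0 Pav; rewrite ler_norml => /andP[_].
  have := metric_triangle a0 x a; rewrite (metric_sym x a); lra.
have Ele x y : inf (E x) <= inf (E y) + mdist x y.
  rewrite -lerBlDr; apply: lb_le_inf => // _ [a [v [Pav ->]]].
  rewrite lerBlDr; apply: (@le_trans _ _ (v + mdist a x)).
    by apply: ge_inf => //; exists a, v.
  have := metric_triangle a y x; rewrite (metric_sym y x); lra.
exists (fun x => inf (E x)) => [x y|a v Pav].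
  rewrite ler_norml; apply/andP; split.
    by have := Ele y x; rewrite (metric_sym y x); lra.
  by have := Ele x y; lra.
apply/eqP; rewrite eq_le; apply/andP; split.
  by apply: ge_inf => //; exists a, v; rewrite mdistxx addr0.
apply: lb_le_inf => // _ [a' [v' [Pav' ->]]].
have := Plip _ _ _ _ Pav Pav'; rewrite ler_norml metric_sym => /andP[_]; lra.
Qed.

Section star_amalgam.
Context {R : realType} (X : nat -> polishMetricType R) (Xoo : polishMetricType R).
Context (rel : forall n, X n -> Xoo -> Prop).
Hypothesis rel_nonempty : forall n, exists a b, rel (n := n) a b.
Hypothesis rel_isometric : forall n a b a' b',
  rel (n := n) a b -> rel a' b' -> mdist a a' = mdist b b'.

Let Z := ({n & X n} + Xoo)%type.
Let inX n (x : X n) : Z := inl (existT (fun n => X n : Type) n x).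
Let inoo (y : Xoo) : Z := inr y.

Let compatible : set (Z -> R) := [set f |
  [/\ forall n (x x' : X n), `|f (inX x) - f (inX x')| <= mdist x x',
      forall y y', `|f (inoo y) - f (inoo y')| <= mdist y y' &
      forall n a b, rel (n := n) a b -> f (inX a) = f (inoo b)]].

(** The spaces [X m] interact only through [Xoo]. Once [g] is fixed there, each [X m] with m
    different from n can be treated alone: [rel] is isometric, so [g] transported along it is
    1-Lipschitz and extends by McShane. *)
Let compatible_extension (g : Xoo -> R) n (h : X n -> R) :
  (forall y y', `|g y - g y'| <= mdist y y') ->
  (forall x x', `|h x - h x'| <= mdist x x') ->
  (forall a b, rel a b -> h a = g b) ->
  exists f, [/\ compatible f, forall x : X n, f (inX x) = h x &
    forall y, f (inoo y) = g y].
Proof.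
move=> glip hlip hg.
have kex m : exists k : X m -> R,
    [/\ forall x x', `|k x - k x'| <= mdist x x',
        forall a b, rel a b -> k a = g b &
        (* The cast states that [k] is [h] when m is n, although the types [X m] and [X n] are then
           only propositionally equal. *)
        forall (e : n = m) x, k (eq_rect n (fun n => X n : Type) x m e) = h x].
  have [nm|nm] := pselect (n = m).
    case: m / nm; exists h; split => // e x.
    by rewrite (Prop_irrelevance e erefl).
  have [||k klip kP] := @mcshane_extension R (X m)
      (fun a v => exists2 b, rel a b & v = g b).
  - by have [a [b ab]] := rel_nonempty m; exists a, (g b), b.
  - move=> a v a' v' [b ab ->] [b' ab' ->].
    by rewrite (rel_isometric ab ab'); exact: glip.
  by exists k; split => // a b ab; apply: kP; exists b.
pose k m := sval (cid (kex m)); have kP m := svalP (cid (kex m)).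
pose f (z : Z) := match z with inl x => k (projT1 x) (projT2 x) | inr y => g y end.
exists f; split => // [|x]; last by have [_ _ /(_ erefl x)] := kP n.
split => // m; first by have [] := kP m.
by have [] := kP m.
Qed.

(** The distance to [x] is first carried to [Xoo] along [rel] and extended there, then to the other
    spaces. It attains the supremum that defines the amalgamated distance from [x] inside [X n]. *)
Let extension_point n (x : X n) : exists f, compatible f /\
  forall x' : X n, f (inX x') = mdist x x'.
Proof.
have [||g glip gP] := @mcshane_extension R Xoo
    (fun b v => exists2 a, rel (n := n) a b & v = mdist x a).
- by have [a [b ab]] := rel_nonempty n; exists b, (mdist x a), a.
- move=> b v b' v' [a ab ->] [a' ab' ->]; rewrite -(rel_isometric ab ab').
  exact: mdist_lipschitz.
have [|||f [cf fx _]] := @compatible_extension g n (mdist x).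
- exact: glip.
- by move=> *; exact: mdist_lipschitz.
- by move=> a b ab; rewrite (gP b (mdist x a))//; exists a.
by exists f.
Qed.

Let extension_pointoo (y : Xoo) : exists f, compatible f /\
  forall y', f (inoo y') = mdist y y'.
Proof.
(* Index 0 is arbitrary: [compatible_extension] asks for the function on one of the spaces [X n]. *)
have [||h hlip hP] := @mcshane_extension R (X 0%N)
    (fun a v => exists2 b, rel (n := 0%N) a b & v = mdist y b).
- by have [a [b ab]] := rel_nonempty 0%N; exists a, (mdist y b), b.
- move=> a v a' v' [b ab ->] [b' ab' ->]; rewrite (rel_isometric ab ab').
  exact: mdist_lipschitz.
have [|||f [cf _ fy]] := @compatible_extension (mdist y) 0%N h.
- by move=> *; exact: mdist_lipschitz.
- exact: hlip.
- by move=> a b ab; apply: hP; exists b.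
by exists f.
Qed.

(* As a supremum over compatible 1-Lipschitz functions, the amalgamated distance
   satisfies the triangle inequality for free; that it restricts to the given
   distances amounts to McShane's extension theorem. *)
Let amalgam_dist (z w : Z) : R := sup [set `|f z - f w| | f in compatible].

(** A chain from z to w through [Xoo] bounds the supremum; this is where every [rel n] has to be
    nonempty. *)
Let anchor (z : Z) : exists (b : Xoo) (r : R), forall f, compatible f ->
  `|f z - f (inoo b)| <= r.
Proof.
case: z => [[n x]|y].
  have [a [b ab]] := rel_nonempty n; exists b, (mdist x a) => f [flip _ fab].
  by rewrite -(fab _ _ _ ab); exact: flip.
by exists y, 0 => f _; rewrite subrr normr0.
Qed.

Let amalgam_has_sup z w : has_sup [set `|f z - f w| | f in compatible].
Proof.
have [b [r br]] := anchor z; have [b' [r' br']] := anchor w; split.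
  by have [f [cf _]] := extension_pointoo point; exists `|f z - f w|, f.
exists (r + mdist b b' + r') => _ [f cf <-].
apply: le_trans (ler_distD (f (inoo b)) _ _) _.
rewrite -addrA lerD ?br//; apply: le_trans (ler_distD (f (inoo b')) _ _) _.
rewrite lerD//; first by case: cf.
by rewrite distrC br'.
Qed.

Let amalgam_dist_ub z w f : compatible f -> `|f z - f w| <= amalgam_dist z w.
Proof. by move=> cf; apply: (ub_le_sup (amalgam_has_sup z w).2); exists f. Qed.

Let amalgam_dist_le z w (r : R) :
  (forall f, compatible f -> `|f z - f w| <= r) -> amalgam_dist z w <= r.
Proof.
move=> h; apply: ge_sup; first exact: (amalgam_has_sup z w).1.
by move=> _ [f cf <-]; exact: h.
Qed.

Let amalgam_distxx z : amalgam_dist z z = 0.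
Proof.
apply/eqP; rewrite eq_le; apply/andP; split.
  by apply: amalgam_dist_le => f _; rewrite subrr normr0.
have [f [cf _]] := extension_pointoo point.
exact: le_trans (amalgam_dist_ub z z cf).
Qed.

Let amalgam_dist_sym z w : amalgam_dist z w = amalgam_dist w z.
Proof.
by apply/eqP; rewrite eq_le; apply/andP; split; apply: amalgam_dist_le => f cf;
  rewrite distrC; exact: amalgam_dist_ub.
Qed.

Let amalgam_dist_triangle w z u :
  amalgam_dist z u <= amalgam_dist z w + amalgam_dist w u.
Proof.
apply: amalgam_dist_le => f cf; apply: le_trans (ler_distD (f w) _ _) _.
by rewrite lerD ?amalgam_dist_ub.
Qed.

Let amalgam_dist_inX n (x x' : X n) : amalgam_dist (inX x) (inX x') = mdist x x'.
Proof.
apply/eqP; rewrite eq_le; apply/andP; split.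
  by apply: amalgam_dist_le => f [+ _ _]; exact.
have [f [cf fx]] := extension_point x.
have := amalgam_dist_ub (inX x) (inX x') cf; rewrite !fx mdistxx sub0r normrN.
by apply: le_trans; rewrite ler_norm.
Qed.

Let amalgam_dist_inoo y y' : amalgam_dist (inoo y) (inoo y') = mdist y y'.
Proof.
apply/eqP; rewrite eq_le; apply/andP; split.
  by apply: amalgam_dist_le => f [_ + _]; exact.
have [f [cf fy]] := extension_pointoo y.
have := amalgam_dist_ub (inoo y) (inoo y') cf; rewrite !fy mdistxx sub0r normrN.
by apply: le_trans; rewrite ler_norm.
Qed.

Let amalgam_dist_rel n a b : rel (n := n) a b -> amalgam_dist (inX a) (inoo b) = 0.
Proof.
move=> ab; apply/eqP; rewrite eq_le; apply/andP; split.
  by apply: amalgam_dist_le => f [_ _ fab]; rewrite (fab _ _ _ ab) subrr normr0.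
have [f [cf _]] := extension_pointoo point.
exact: le_trans (amalgam_dist_ub _ _ cf).
Qed.

Let amalgam_dist_separable : exists s : nat -> Z,
  forall x (e : R), 0 < e -> exists n, amalgam_dist x (s n) < e.
Proof.
pose s n := sval (cid (dense_sequence (X n))).
have sP n := svalP (cid (dense_sequence (X n))).
have [t tP] := dense_sequence Xoo.
exists (fun k => match @unpickle (option nat * nat)%type k with
  | Some (Some n, j) => inX (s n j)
  | Some (None, j) => inoo (t j)
  | None => inoo point end) => -[[n x]|y] e e0.
  have [j xj] := sP n x e e0; rewrite -/(s n) in xj; exists (pickle (Some n, j)).
  by rewrite pickleK amalgam_dist_inX.
have [j yj] := tP y e e0; exists (pickle (@None nat, j)).
by rewrite pickleK amalgam_dist_inoo.
Qed.

Let amalgam_pdist := SeparablePdist amalgam_distxx amalgam_dist_sym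
  amalgam_dist_triangle amalgam_dist_separable.

Lemma star_amalgam : exists (Y : polishMetricType R)
  (iota : forall n, isometric_embedding (X n) Y)
  (iotaoo : isometric_embedding Xoo Y),
  forall n a b, rel (n := n) a b -> iota n a = iotaoo b.
Proof.
have iE n (x x' : X n) : mdist (completion_embed amalgam_pdist (inX x))
    (completion_embed amalgam_pdist (inX x')) = mdist x x'.
  by rewrite mdist_completion_embed; exact: amalgam_dist_inX.
have iooE y y' : mdist (completion_embed amalgam_pdist (inoo y))
    (completion_embed amalgam_pdist (inoo y')) = mdist y y'.
  by rewrite mdist_completion_embed; exact: amalgam_dist_inoo.
exists (completion amalgam_pdist), (fun n => IsometricEmbedding (iE n)),
  (IsometricEmbedding iooE) => n a b ab /=.
(* Related points are distinct in [Z] but at distance 0, and the completion identifies them. Hence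
   the construction starts from a pseudo-distance. *)
apply: mdist_positivity; rewrite mdist_completion_embed.
exact: amalgam_dist_rel.
Qed.

End star_amalgam.

(** * Borel sets and sequences in Polish metric spaces *)

Lemma natSinv_lt (R : realType) (e : R) : 0 < e ->
  exists n, forall m, (n <= m)%N -> m.+1%:R^-1 < e.
Proof.
move=> e0; have [n _ nP] := near_infty_natSinv_lt (PosNum e0).
by exists n => m nm; exact: nP.
Qed.

Lemma open_borel (T : ptopologicalType) (U : set T) :
  open U -> measurable (U : set (borel T)).
Proof. by move=> oU; exact: sub_sigma_algebra. Qed.

Lemma closed_borel (T : ptopologicalType) (C : set T) :
  closed C -> measurable (C : set (borel T)).
Proof.
by rewrite -openC => oC; rewrite -[C]setCK; apply: measurableC; exact: open_borel.
Qed.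

Lemma preimage_borel (S T : ptopologicalType) (f : S -> T) (B : set (borel T)) :
  continuous f -> measurable B -> measurable (f @^-1` B : set (borel S)).
Proof.
move=> cf mB; rewrite -[X in measurable X]setTI.
exact: (continuous_borel cf measurableT mB).
Qed.

Lemma borelX (S T : ptopologicalType) (A : set (borel S)) (B : set (borel T)) :
  measurable A -> measurable B ->
  measurable (A `*` B : set (borel (S * T)%type)).
Proof.
move=> mA mB.
have -> : A `*` B = (fst @^-1` A) `&` (snd @^-1` B) by [].
apply: measurableI.
- exact: (preimage_borel (@fst_continuous S T) mA).
- exact: (preimage_borel (@snd_continuous S T) mB).
Qed.

Lemma ball_open_metric (R : realType) (X : metricType R) (x : X) (r : R) :
  open (ball x r).
Proof.
rewrite ballEmdist openE => y /= xy; rewrite /interior.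
apply/metricType_numDomainType.nbhs_mdistP.
exists (r - mdist x y); first by rewrite /= subr_gt0.
by move=> z /= yz; have := metric_triangle x y z; lra.
Qed.

Lemma countable_base (R : realType) (X : polishMetricType R) :
  exists V : nat -> set X, (forall k, open (V k)) /\
    forall (U : set X) x, open U -> U x -> exists k, V k x /\ V k `<=` U.
Proof.
have [s sP] := dense_sequence X.
exists (fun k => let ij := odflt (0%N, 0%N) (@unpickle (nat * nat)%type k) in
  ball (s ij.1) (ij.2.+1%:R^-1 : R)).
split=> [k|U x oU Ux]; first exact: ball_open_metric.
have /metricType_numDomainType.nbhs_mdistP [e /= e0 eU] := open_nbhs_nbhs (conj oU Ux).
have [n nP] := natSinv_lt (divr_gt0 e0 (ltr0n R 2)).
have n0 : 0 < n.+1%:R^-1 :> R by rewrite invr_gt0.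
have [i xi] := sP x _ n0; exists (pickle (i, n)).
rewrite /= pickleK ballEmdist /=; split; first by rewrite metric_sym.
move=> y /= iy; apply: eU => /=; have := metric_triangle x (s i) y.
have := nP n (leqnn n); move: xi iy; set q := n.+1%:R^-1; lra.
Qed.

Lemma cauchy_sequence_cvg (R : realType) (X : polishMetricType R) (u : nat -> X) :
  (forall m n, mdist (u m) (u n) <= m.+1%:R^-1 + n.+1%:R^-1) ->
  exists y, forall m, mdist (u m) y <= m.+1%:R^-1.
Proof.
move=> uc; have /cauchy_cvg/cvg_ex [y uy] : cauchy (u @ \oo).
  apply: cauchy_exP => e e0.
  have [n nP] := natSinv_lt (divr_gt0 e0 (ltr0n R 2)); exists (u n).
  exists n => // m /= nm; rewrite ballEmdist /=.
  have := uc n m; have := nP _ nm; have := nP _ (leqnn n).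
  set q := n.+1%:R^-1; set r := m.+1%:R^-1; lra.
exists y => m; apply/ler_addgt0Pl => e e0.
have /metricType_numDomainType.cvgrPdist_lt := uy.
move=> /(_ _ (divr_gt0 e0 (ltr0n R 2))) [n _ nP].
have [k kP] := natSinv_lt (divr_gt0 e0 (ltr0n R 2)).
have := nP (maxn n k) (leq_maxl _ _); have := kP (maxn n k) (leq_maxr _ _).
have := uc m (maxn n k); have := metric_triangle (u m) (u (maxn n k)) y.
by rewrite (metric_sym y); set q := m.+1%:R^-1; set r := _.+1%:R^-1; lra.
Qed.

(** Compactness gives a cluster point, and a cluster point of an ultrafilter is a limit. *)
Lemma ultrafilter_cvg (R : realType) (F : set_system nat) (u : nat -> R) (M : R) :
  UltraFilter F -> (forall k, `|u k| <= M) -> exists l : R, u @ F --> l.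
Proof.
move=> FU uM.
have FuM : (u @ F) `[- M, M]%classic.
  suff : F [set k | `[- M, M]%classic (u k)] by [].
  by apply: filterS filterT => k _ /=; rewrite in_itv /= -ler_norml.
have [l [_ ul]] := @segment_compact R (- M) M (u @ F) _ FuM.
exists l => V Vl; have [//|FnV] := in_ultra_setVsetC (u @^-1` V) FU.
by have [x [/= nVx Vx]] := ul (~` V) V FnV Vl.
Qed.

(** * Finitely additive couplings *)

Section dominated_bimeasure.
Context {R : realType} (slope : R -> R) (delta : R).

(* [slope a * (nu A - a * mu A) <= delta] for all [a] is what is left, at the
   level of sets, of a bound [delta] on the entropy of [nu] relative to [mu]. *)
Record dominated_bimeasure (X1 X2 : polishMetricType R)
    (mu1 : borel_measure R X1) (mu2 : borel_measure R X2)
    (beta : set (borel X1) -> set (borel X2) -> R) : Prop := {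
  bim_ge0 : forall A B, measurable A -> measurable B -> 0 <= beta A B ;
  bimUl : forall A A' B, measurable A -> measurable A' -> measurable B ->
    A `&` A' = set0 -> beta (A `|` A') B = beta A B + beta A' B ;
  bimUr : forall A B B', measurable A -> measurable B -> measurable B' ->
    B `&` B' = set0 -> beta A (B `|` B') = beta A B + beta A B' ;
  bim_doml : forall a A, 0 < a -> measurable A ->
    slope a * (beta A setT - a * fine (mu1 A)) <= delta ;
  bim_domr : forall a B, 0 < a -> measurable B ->
    slope a * (beta setT B - a * fine (mu2 B)) <= delta }.

Lemma dominated_bimeasureC (X1 X2 : polishMetricType R) (mu1 : borel_measure R X1)
    (mu2 : borel_measure R X2) beta :
  dominated_bimeasure mu1 mu2 beta ->
  dominated_bimeasure mu2 mu1 (fun B A => beta A B).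
Proof. by case=> ? ? ? ? ?; split=> *; auto. Qed.

(** The form in which isometry survives the limit: points may have no mass, so it speaks of
    rectangles of positive mass, and the pairs found in them are isometric only up to [e]. *)
Definition bim_isometric (X1 X2 : polishMetricType R)
    (beta : set (borel X1) -> set (borel X2) -> R) :=
  forall A B A' B', measurable A -> measurable B ->
    measurable A' -> measurable B' -> 0 < beta A B -> 0 < beta A' B' ->
    forall e : R, 0 < e -> exists (x : X1) (y : X2) (x' : X1) (y' : X2),
      [/\ A x, B y, A' x', B' y' & `|mdist x x' - mdist y y'| <= e].

Lemma bim_isometricC (X1 X2 : polishMetricType R) beta : @bim_isometric X1 X2 beta ->
  bim_isometric (fun B A => beta A B).
Proof.
move=> h B A B' A' mB mA mB' mA' BA BA' e e0.
have [x [y [x' [y' [Ax By Ax' By' xy]]]]] := h _ _ _ _ mA mB mA' mB' BA BA' e e0.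
by exists y, x, y', x'; rewrite distrC.
Qed.

(** The support of [beta] seen as a measure on the product. Finite additivity alone would allow it
    to be empty even when [beta] is not zero. *)
Definition bim_support (X1 X2 : polishMetricType R)
    (beta : set (borel X1) -> set (borel X2) -> R) (x : X1) (y : X2) : Prop :=
  forall r : R, 0 < r -> 0 < beta (ball x r) (ball y r).

Section theory.
Context (X1 X2 : polishMetricType R).
Context (mu1 : borel_measure R X1) (mu2 : borel_measure R X2).
Context (beta : set (borel X1) -> set (borel X2) -> R).
Hypothesis betaP : dominated_bimeasure mu1 mu2 beta.

Lemma bim0l B : measurable B -> beta set0 B = 0.
Proof.
move=> mB; have := bimUl betaP measurable0 measurable0 mB (setI0 _).
by rewrite setU0 => /eqP; rewrite -subr_eq0 opprD addNKr oppr_eq0 => /eqP.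
Qed.

Lemma bim_lel A A' B : measurable A -> measurable A' -> measurable B ->
  A `<=` A' -> beta A B <= beta A' B.
Proof.
move=> mA mA' mB AA'; rewrite -(setDUK AA') (bimUl betaP) //; last first.
- by apply: setDIK.
- exact: measurableD.
by rewrite lerDl (bim_ge0 betaP)//; exact: measurableD.
Qed.

Lemma bim_ler A B B' : measurable A -> measurable B -> measurable B' ->
  B `<=` B' -> beta A B <= beta A B'.
Proof.
move=> mA mB mB' BB'; rewrite -(setDUK BB') (bimUr betaP) //; last first.
- by apply: setDIK.
- exact: measurableD.
by rewrite lerDl (bim_ge0 betaP)//; exact: measurableD.
Qed.

Lemma bim_subUl A A' B : measurable A -> measurable A' -> measurable B ->
  beta (A `|` A') B <= beta A B + beta A' B.
Proof.
move=> mA mA' mB; have -> : A `|` A' = A `|` (A' `\` A).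
  apply/seteqP; split => x [Ax|A'x]; [by left| |by left|by right; case: A'x].
  by have [Ax|Ax] := pselect (A x); [left|right].
rewrite (bimUl betaP)//; last 2 first.
- exact: measurableD.
- by rewrite setDE setICA setICr setI0.
rewrite lerD2l; apply: bim_lel => //.
exact: measurableD.
Qed.

Hypothesis slope_unbounded : forall t : R, exists2 a, 0 < a & t <= slope a.

(** Dividing the tangent inequality by [slope a] bounds beta A setT by a * mu1 A + delta / slope a,
    whose last term is at most [e] when [slope a] is large. *)
Lemma bim_abs_cont (e : R) : 0 < e -> exists2 c : R, 0 < c &
  forall A B, measurable A -> measurable B -> beta A B <= c * fine (mu1 A) + e.
Proof.
(* The maximum with 1 makes the slope positive, whatever the sign of [delta]. *)
move=> e0; have [a a0 at_] := slope_unbounded (Num.max 1 (delta / e)).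
have sa0 : 0 < slope a by apply: lt_le_trans at_; rewrite lt_max ltr01.
exists a => // A B mA mB; apply: (@le_trans _ _ (beta A setT)).
  exact: bim_ler.
have := bim_doml betaP a0 mA; rewrite mulrC -ler_pdivlMr// lerBlDl => h.
apply: le_trans h _; rewrite lerD2l ler_pdivrMr// mulrC -ler_pdivrMr//.
by apply: le_trans at_; rewrite le_max lexx orbT.
Qed.

(** This replaces countable additivity. Finite unions are null by additivity; the rest of the union
    has small [mu1]-measure, hence small mass by [bim_abs_cont]. *)
Lemma bim_bigcup0l (A : nat -> set (borel X1)) B :
  (forall n, measurable (A n)) -> measurable B ->
  (forall n, beta (A n) B = 0) -> beta (\bigcup_n A n) B = 0.
Proof.
move=> mA mB A0; apply/eqP; rewrite eq_le (bim_ge0 betaP) ?andbT//; last first.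
  exact: bigcupT_measurable.
apply/ler_addgt0Pl => e e0; rewrite addr0.
have e20 : 0 < e / 2 by rewrite divr_gt0.
have [c c0 cP] := bim_abs_cont e20.
pose U n := \big[setU/set0]_(i < n) A i.
have mU n : measurable (U n) by apply: bigsetU_measurable.
have UE n : U n.+1 = U n `|` A n by rewrite /U big_ord_recr.
have U0 n : beta (U n) B = 0.
  elim: n => [|n IHn]; first by rewrite /U big_ord0 bim0l.
  apply/eqP; rewrite eq_le (bim_ge0 betaP)// andbT UE.
  by rewrite (le_trans (bim_subUl _ _ _))// IHn A0 addr0.
pose T n := \bigcup_n A n `\` U n.
have mT n : measurable (T n) by apply: measurableD => //; exact: bigcupT_measurable.
have T0 : mu1 \o T @ \oo --> 0%E.
  rewrite -(measure0 mu1); have -> : set0 = \bigcap_n T n.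
    apply/esym; rewrite -subset0 => x Tx.
    have [[n _ Anx] _] := Tx 0%N I.
    by have [_ +] := Tx n.+1 I; apply; rewrite UE; right.
  apply: nonincreasing_cvg_mu => //.
  - by rewrite ltey_eq fin_num_measure.
  - by apply: bigcap_measurableType => n _; exact: mT.
  - move=> m n mn; apply/subsetPset; apply: setDS.
    exact: subset_bigsetU.
have fT0 : fine (mu1 (T n)) @[n --> \oo] --> (0 : R).
  by have /fine_cvg := T0.
have c20 : 0 < e / 2 / c by rewrite divr_gt0.
have /cvgrPdist_lt /(_ _ c20) [n _ /(_ _ (leqnn n))] := fT0.
rewrite sub0r normrN ger0_norm ?fine_ge0// ltr_pdivlMr// => Tn.
have -> : \bigcup_n A n = U n `|` T n.
  rewrite setDUK// => x; rewrite /U -bigcup_mkord => -[i _ Ai]; by exists i.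
apply: le_trans (bim_subUl _ _ _) _ => //; rewrite U0 add0r.
by have := cP _ _ (mT n) mB; lra.
Qed.

End theory.

(** * The support of an isometric coupling *)

Section support.
Context (X1 X2 : polishMetricType R).
Context (mu1 : borel_measure R X1) (mu2 : borel_measure R X2).
Context (beta : set (borel X1) -> set (borel X2) -> R).
Hypothesis betaP : dominated_bimeasure mu1 mu2 beta.
Hypothesis beta_iso : bim_isometric beta.
Hypothesis slope_unbounded : forall t : R, exists2 a, 0 < a & t <= slope a.

Lemma bim_bigcup0r A (B : nat -> set (borel X2)) :
  (forall n, measurable (B n)) -> measurable A ->
  (forall n, beta A (B n) = 0) -> beta A (\bigcup_n B n) = 0.
Proof. exact: (bim_bigcup0l (dominated_bimeasureC betaP)). Qed.

Let ball_borel (X : polishMetricType R) (x : X) (r : R) :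
  measurable (ball x r : set (borel X)).
Proof. by apply: open_borel; exact: ball_open_metric. Qed.

Lemma bim_support_isometric x y x' y' :
  bim_support beta x y -> bim_support beta x' y' -> mdist x x' = mdist y y'.
Proof.
move=> xy xy'; apply/eqP; rewrite -subr_eq0 -normr_le0; apply/ler_addgt0Pl => e e0.
(* Four displacements inside the balls and the error of [beta_iso], each at most e / 5. *)
have e50 : 0 < e / 5 by rewrite divr_gt0.
have [] := beta_iso _ _ _ _ (xy _ e50) (xy' _ e50) e50; try exact: ball_borel.
move=> u [v [u' [v' []]]]; rewrite !ballEmdist /= => xu yv xu' yv'.
rewrite !ler_norml => /andP[? ?]; rewrite addr0.
have := metric_triangle x u x'; have := metric_triangle u x x'.
have := metric_triangle u u' x'; have := metric_triangle u x' u'.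
have := metric_triangle y v y'; have := metric_triangle v y y'.
have := metric_triangle v v' y'; have := metric_triangle v y' v'.
rewrite (metric_sym u x) (metric_sym v y) (metric_sym u' x') (metric_sym v' y').
by move=> *; apply/andP; split; lra.
Qed.

(* Almost every [x] lies, for every [m], in the support of some
   [beta (_ `&` A) P] with [P] contained in a ball of radius [1/m] and in [B];
   by the isometry property these balls form a Cauchy sequence. *)
Lemma bim_support_exists A B : measurable A -> measurable B -> 0 < beta A B ->
  exists (x : X1) (y : X2), [/\ A x, closure B y & bim_support beta x y].
Proof.
move=> mA mB AB0.
have [V [oV VP]] := countable_base X1.
have [s sP] := dense_sequence X2.
pose P m j : set (borel X2) := B `&` ball (s j) (m.+1%:R^-1 : R).
have mP m j : measurable (P m j) by apply: measurableI.
pose W m j k : set (borel X1) :=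
  if `[< beta (A `&` V k) (P m j) = 0 >] then A `&` V k else set0.
have mAV k : measurable (A `&` V k : set (borel X1)).
  by apply: measurableI => //; exact: open_borel.
have mW m j k : measurable (W m j k) by rewrite /W; case: ifP.
have W0 m j k : beta (W m j k) (P m j) = 0.
  by rewrite /W; case: ifPn => [/asboolP//|_]; rewrite (bim0l betaP).
pose WW m j := \bigcup_k W m j k.
have mWW m j : measurable (WW m j) by exact: bigcupT_measurable.
have WW0 m j : beta (WW m j) (P m j) = 0 by apply: (bim_bigcup0l betaP).
(* The points of [A] having, for every [j], a neighbourhood whose trace on [A] is null against
   [P m j]. As the [P m j] cover [B], this set is null against [B]. *)
pose N m := \bigcap_j WW m j.
have mN m : measurable (N m) by apply: bigcap_measurableType => j _; exact: mWW.
have N0 m : beta (N m) B = 0.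
  have -> : B = \bigcup_j P m j.
    apply/seteqP; split => [y By|y [j _ []]//].
    have [j yj] := sP y (m.+1%:R^-1) (ltac:(by rewrite invr_gt0)).
    by exists j => //; split => //; rewrite ballEmdist /= metric_sym.
  apply: bim_bigcup0r => // j; apply/eqP; rewrite eq_le (bim_ge0 betaP)// andbT.
  by rewrite -(WW0 m j) (bim_lel betaP)// => x; exact.
have NN0 : beta (\bigcup_m N m) B = 0 by apply: (bim_bigcup0l betaP).
have [x [Ax Nx]] : exists x, A x /\ ~ (\bigcup_m N m) x.
  apply/not_existsP => AN; move: AB0; apply/negP; rewrite -leNgt -NN0.
  apply: (bim_lel betaP) => //; first exact: bigcupT_measurable.
  by move=> x Ax; have /not_andP [//|/contrapT] := AN x.
(* Since [x] avoids every [N m], each scale [m] has a ball, of index [j m], whose trace on [B] is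
   charged by all neighbourhoods of [x] in [A]. *)
have /choice [j jP] m : exists j, forall U : set X1, open U -> U x ->
    0 < beta (A `&` U) (P m j).
  have /existsNP [j Wx] : ~ forall j, WW m j x.
    by move=> h; apply: Nx; exists m => // j _; exact: h.
  exists j => U oU Ux.
  have [k [Vkx VkU]] := VP U x oU Ux.
  apply: (@lt_le_trans _ _ (beta (A `&` V k) (P m j))); last first.
    apply: (bim_lel betaP) => //; last exact: setIS.
    by apply: measurableI => //; exact: open_borel.
  rewrite lt_neqAle (bim_ge0 betaP)// andbT; apply/negP => /eqP h; apply: Wx.
  by exists k => //; rewrite /W ifT//; apply/asboolP.
(* Both rectangles have the same first side, of diameter at most 2e / 3, so the isometry property
   brings the two balls within [e] of each other. *)
have jC m n : mdist (s (j m)) (s (j n)) <= m.+1%:R^-1 + n.+1%:R^-1.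
  apply/ler_addgt0Pl => e e0; have e30 : 0 < e / 3 by rewrite divr_gt0.
  have ox : open (ball x (e / 3)) by exact: ball_open_metric.
  have xx : ball x (e / 3) x by exact: ballxx.
  have mx : measurable (A `&` ball x (e / 3) : set (borel X1)).
    by apply: measurableI.
  have [] := beta_iso mx (mP _ _) mx (mP _ _) (jP m _ ox xx) (jP n _ ox xx) e30.
  move=> u [v [u' [v' []]]]; rewrite /P !ballEmdist /= => -[_ xu] [_ mv] [_ xu'] [_ nv'].
  rewrite ler_norml => /andP[+ _].
  have := metric_triangle u x u'; have := metric_triangle (s (j m)) v (s (j n)).
  have := metric_triangle v v' (s (j n)); rewrite (metric_sym u x) (metric_sym v' (s _)).
  by move: mv nv'; set q := m.+1%:R^-1; set r := n.+1%:R^-1; lra.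
have [y yP] := cauchy_sequence_cvg jC.
have Py (r : R) : 0 < r -> exists m, P m (j m) `<=` B `&` ball y r.
  move=> r0; have [m mP'] := natSinv_lt (divr_gt0 r0 (ltr0n R 2)); exists m.
  move=> z [Bz]; rewrite !ballEmdist /= => zj; split => //=.
  have := mP' m (leqnn m); have := yP m; have := metric_triangle y (s (j m)) z.
  by rewrite (metric_sym y (s _)); move: zj; set q := m.+1%:R^-1; lra.
exists x, y; split => //.
(* [y] is only a limit of points of [B], hence the closure in the statement; [P m (j m)] is nonempty
   because it has positive mass. *)
- move=> U /metricType_numDomainType.nbhs_mdistP [e /= e0 eU].
  have [m mP'] := Py e e0.
  have [z Pz] : P m (j m) !=set0.
    apply/set0P/eqP => P0; have := jP m setT openT I; rewrite P0.
    by rewrite (bim0l (dominated_bimeasureC betaP)) ?ltxx//; apply: measurableI.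
  by have [Bz] := mP' _ Pz; rewrite ballEmdist /= => yz; exists z; split => //; exact: eU.
- move=> r r0; have [m mP'] := Py r r0.
  have ox : open (ball x r) by exact: ball_open_metric.
  apply: lt_le_trans (jP m _ ox (ballxx _ r0)) _.
  apply: (@le_trans _ _ (beta (ball x r) (P m (j m)))).
    by apply: (bim_lel betaP) => //; exact: measurableI.
  by apply: (bim_ler betaP) => // z /mP' [].
Qed.

End support.

(** * Equality of the two marginals in a glued space *)

Section agreement.
Context (X1 X2 : polishMetricType R).
Context (mu1 : borel_measure R X1) (mu2 : borel_measure R X2).
Context (beta : set (borel X1) -> set (borel X2) -> R).
Hypothesis betaP : dominated_bimeasure mu1 mu2 beta.
Hypothesis beta_iso : bim_isometric beta.
Hypothesis slope_unbounded : forall t : R, exists2 a, 0 < a & t <= slope a.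
Context (Y : polishMetricType R).
Context (iota1 : isometric_embedding X1 Y) (iota2 : isometric_embedding X2 Y).
Hypothesis agree : forall x y, bim_support beta x y -> iota1 x = iota2 y.

Let mpre (X : polishMetricType R) (iota : isometric_embedding X Y)
  (C : set (borel Y)) :
  measurable C -> measurable (iota @^-1` C : set (borel X)).
Proof. exact: (preimage_borel (@embedding_continuous _ _ _ iota)). Qed.

(** The coupling is carried by the preimage of the diagonal of [Y]. The sets [C] with this property
    form a sigma-algebra; it contains the open sets, since a charged off-diagonal rectangle would
    contain a pair of the support, on which the embeddings agree. *)
Lemma bim_diagonal (C : set (borel Y)) : measurable C ->
  beta (iota1 @^-1` C) (iota2 @^-1` (~` C)) = 0 /\
  beta (iota1 @^-1` (~` C)) (iota2 @^-1` C) = 0.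
Proof.
(* Keeping both equalities makes the class stable under complement. *)
pose G : set (set (borel Y)) := [set C : set (borel Y) | measurable C /\
  (beta (iota1 @^-1` C) (iota2 @^-1` (~` C)) = 0 /\
   beta (iota1 @^-1` (~` C)) (iota2 @^-1` C) = 0)].
have ge0 (C1 C2 : set (borel Y)) : measurable C1 -> measurable C2 ->
    (0 < beta (iota1 @^-1` C1) (iota2 @^-1` C2) -> False) ->
    beta (iota1 @^-1` C1) (iota2 @^-1` C2) = 0.
  move=> mC1 mC2 h; apply/eqP; rewrite eq_le; apply/andP; split.
    by rewrite leNgt; apply/negP.
  by apply: (bim_ge0 betaP); exact: mpre.
have preC (X : polishMetricType R) (iota : isometric_embedding X Y) (D : set Y) :
  closed D -> closure (iota @^-1` D) = iota @^-1` D.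
  move=> cD; apply/esym/closure_id; apply: preimage_closed => // x _.
  exact: embedding_continuous.
suff : <<s @open Y >> `<=` G by move=> h mC; have [] := h _ mC.
apply: smallest_sub => [|U oU].
  split => /= [|A [mA [A1 A2]]|F GF].
  - split; first exact: measurable0.
    rewrite !preimage_set0; split.
      by rewrite (bim0l betaP)//; apply: mpre; exact: measurableC.
    by rewrite (bim0l (dominated_bimeasureC betaP))//; apply: mpre; exact: measurableC.
  - rewrite setTD; split; first exact: measurableC.
    by rewrite setCK.
  - have mF n : measurable (F n : set (borel Y)) by have [] := GF n.
    have mUF : measurable (\bigcup_n F n : set (borel Y)) by exact: bigcupT_measurable.
    have mCF n := measurableC (mF n); have mCUF := measurableC mUF.
    split => //; split.
    + rewrite preimage_bigcup; apply: (bim_bigcup0l betaP) => // [n||n].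
      * exact: mpre.
      * by apply: mpre; exact: measurableC.
      * apply/eqP; rewrite eq_le (bim_ge0 betaP) ?andbT; last 2 first.
          exact: mpre.
          by apply: mpre; exact: measurableC.
        have [_ [<- _]] := GF n; apply: (bim_ler betaP);
          [exact: mpre|exact: mpre mCUF|exact: mpre (mCF n)|].
        by apply: preimage_subset; apply: subsetC; exact: bigcup_sup.
    + rewrite (preimage_bigcup _ iota2); apply: (bim_bigcup0r betaP) => // [n||n].
      * exact: mpre.
      * by apply: mpre; exact: measurableC.
      * apply/eqP; rewrite eq_le (bim_ge0 betaP) ?andbT; last 2 first.
          by apply: mpre; exact: measurableC.
          exact: mpre.
        have [_ [_ <-]] := GF n; apply: (bim_lel betaP);
          [exact: mpre mCUF|exact: mpre (mCF n)|exact: mpre|].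
        by apply: preimage_subset; apply: subsetC; exact: bigcup_sup.
have mU : measurable (U : set (borel Y)) by exact: open_borel.
have mCU := measurableC mU.
split => //; split; apply: ge0 => // h.
- have [] := bim_support_exists betaP beta_iso slope_unbounded _ _ h; try exact: mpre.
  move=> x [y [Ux]]; rewrite preC ?openC//; last exact: open_closedC.
  by move=> /= CUy /agree xy; apply: CUy; rewrite -xy.
(* The factors are exchanged so that the closed set is again in second position, where
   [bim_support_exists] loses a closure. *)
- have [] := bim_support_exists (dominated_bimeasureC betaP) (bim_isometricC beta_iso)
    slope_unbounded _ _ h; try exact: mpre.
  move=> y [x [Uy]]; rewrite preC; last exact: open_closedC.
  move=> /= CUx xy; apply: CUx.
  by rewrite (agree (x := x) (y := y))// => r r0; exact: xy.
Qed.

(** Both sides equal the mass of the product of the two preimages of [C], the off-diagonal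
    rectangles being null. *)
Lemma bim_agreement (C : set (borel Y)) : measurable C ->
  beta (iota1 @^-1` C) setT = beta setT (iota2 @^-1` C).
Proof.
move=> mC; have [C1 C2] := bim_diagonal mC.
have m1 := mpre iota1 mC; have m2 := mpre iota2 mC.
have := bimUr betaP m1 m2 (measurableC m2) (setICr _).
rewrite setUv preimage_setC C1 addr0 => ->.
have := bimUl betaP m1 (measurableC m1) m2 (setICr _).
by rewrite setUv preimage_setC C2 addr0 => ->.
Qed.

End agreement.
End dominated_bimeasure.

(** * Ultralimits of couplings *)

Lemma filter_cvg_le (R : realType) (T : Type) (F : set_system T) (u : T -> R)
  (l c : R) : ProperFilter F -> u @ F --> l -> (forall k, u k <= c) -> l <= c.
Proof.
move=> FF ul uc; rewrite -(cvg_lim _ ul)//; apply: limr_le.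
  by apply/cvg_ex; exists l.
by apply: filterE => k; exact: uc.
Qed.

Section limit_isometry.
Context {R : realType} (slope : R -> R) (delta : R).
Hypothesis slope_unbounded : forall t : R, exists2 a, 0 < a & t <= slope a.
Context (X1 X2 : polishMetricType R).
Context (mu1 : borel_measure R X1) (mu2 : borel_measure R X2).
Context (beta_ : nat -> set (borel X1) -> set (borel X2) -> R).
Hypothesis beta_P : forall k, dominated_bimeasure slope delta mu1 mu2 (beta_ k).
(** For a plan of cost at most [delta] for the distance k d, a rectangle of mass above delta / (k e)
    must contain a pair at distance less than [e]. *)
Hypothesis beta_iso : forall k (e : R) A B A' B', 0 < e ->
  measurable A -> measurable B -> measurable A' -> measurable B' ->
  delta < k%:R * e * beta_ k A B -> delta < k%:R * e * beta_ k A' B' ->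
  exists (x : X1) (y : X2) (x' : X1) (y' : X2),
    [/\ A x, B y, A' x', B' y' & `|mdist x x' - mdist y y'| <= 2 * e].

Lemma bim_limit : exists beta,
  dominated_bimeasure slope delta mu1 mu2 beta /\ bim_isometric beta.
Proof.
(* One ultrafilter gives limits for all pairs of Borel sets at once, which a subsequence could not
   ensure, and makes these limits additive. *)
have [F [FU ooF]] := @ultraFilterLemma nat \oo _.
have /choice [b bP] (AB : set (borel X1) * set (borel X2)) : exists l : R,
    measurable AB.1 -> measurable AB.2 -> beta_ k AB.1 AB.2 @[k --> F] --> l.
  have [[mA mB]|] := pselect (measurable AB.1 /\ measurable AB.2); last first.
    by move=> h; exists 0 => mA mB; exfalso; apply: h.
  have [a a0 at_] := slope_unbounded (Num.max 1 delta).
  have sa0 : 0 < slope a by apply: lt_le_trans at_; rewrite lt_max ltr01.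
  have [|l ul] := @ultrafilter_cvg R F (fun k => beta_ k AB.1 AB.2)
      (a * fine (mu1 setT) + delta / slope a) FU.
  - move=> k; rewrite ger0_norm ?(bim_ge0 (beta_P k))//.
    apply: (@le_trans _ _ (beta_ k setT setT)).
      apply: (@le_trans _ _ (beta_ k AB.1 setT)).
        exact: (bim_ler (beta_P k)).
      exact: (bim_lel (beta_P k)).
    have := bim_doml (beta_P k) a0 measurableT.
    by rewrite mulrC -ler_pdivlMr// lerBlDl.
  - by exists l.
pose beta A B := b (A, B).
have betaP A B : measurable A -> measurable B ->
  beta_ k A B @[k --> F] --> beta A B by exact: (bP (A, B)).
have betaM A B c s : measurable A -> measurable B ->
    s * (beta_ k A B - c) @[k --> F] --> s * (beta A B - c).
  move=> mA mB; apply: cvgM; first exact: cvg_cst.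
  by apply: cvgB; [exact: betaP|exact: cvg_cst].
exists beta; split.
  split.
  - move=> A B mA mB; rewrite -oppr_le0.
    apply: (@filter_cvg_le _ _ F (fun k => - beta_ k A B)).
      by apply: cvgN; exact: betaP.
    by move=> k; rewrite oppr_le0 (bim_ge0 (beta_P k)).
  - move=> A A' B mA mA' mB AA'.
    have := betaP _ _ (measurableU _ _ mA mA') mB.
    have -> : (fun k => beta_ k (A `|` A') B) = (fun k => beta_ k A B + beta_ k A' B).
      by apply/funext => k; exact: (bimUl (beta_P k)).
    move/cvg_unique; apply; first exact: Rhausdorff.
    by apply: cvgD; exact: betaP.
  - move=> A B B' mA mB mB' BB'.
    have := betaP _ _ mA (measurableU _ _ mB mB').
    have -> : (fun k => beta_ k A (B `|` B')) = (fun k => beta_ k A B + beta_ k A B').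
      by apply/funext => k; exact: (bimUr (beta_P k)).
    move/cvg_unique; apply; first exact: Rhausdorff.
    by apply: cvgD; exact: betaP.
  - move=> a A a0 mA; apply: filter_cvg_le (betaM _ _ _ _ mA measurableT) _ => k.
    exact: (bim_doml (beta_P k)).
  - move=> a B a0 mB; apply: filter_cvg_le (betaM _ _ _ _ measurableT mB) _ => k.
    exact: (bim_domr (beta_P k)).
move=> A B A' B' mA mB mA' mB' AB0 AB0' e e0.
(* [beta_iso] doubles its [e]. The number [c] below is a positive lower bound for both masses along
   [F], so the cost condition holds once k exceeds delta / (e / 2 * c). *)
have e20 : 0 < e / 2 by rewrite divr_gt0.
pose c := Num.min (beta A B) (beta A' B') / 2.
have m0 : 0 < Num.min (beta A B) (beta A' B') by rewrite lt_min AB0 AB0'.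
have c0 : 0 < c by rewrite divr_gt0.
have cm : c < Num.min (beta A B) (beta A' B') by rewrite /c; lra.
move: cm; rewrite lt_min => /andP[cAB cAB'].
have near_gt C D : measurable C -> measurable D -> c < beta C D ->
    F [set k | c < beta_ k C D].
  move=> mC mD cCD; have /cvgrPdist_lt := betaP _ _ mC mD.
  move=> /(_ (beta C D - c)); rewrite subr_gt0 => /(_ cCD) h.
  suff : F [set k | `|beta C D - beta_ k C D| < beta C D - c].
    by apply: filterS => k /=; rewrite ltr_norml => /andP[_]; lra.
  exact: h.
have : F [set k | delta / (e / 2 * c) < k%:R].
  apply: ooF; exists (Num.trunc (`|delta / (e / 2 * c)|)).+1 => // k /= kP.
  apply: le_lt_trans (ler_norm _) _.
  apply: lt_le_trans (truncnS_gt _) _.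
  by rewrite ler_nat.
move=> Fk; have [k [[kd kAB] kAB']] := filter_ex
  (filterI (filterI Fk (near_gt _ _ mA mB cAB)) (near_gt _ _ mA' mB' cAB')).
have key u : c < u -> delta < k%:R * (e / 2) * u.
  move=> cu; have ec0 : 0 < e / 2 * c by rewrite mulr_gt0.
  move: kd => /=; rewrite ltr_pdivrMr// => kd; apply: lt_le_trans kd _.
  by rewrite -[leRHS]mulrA ler_wpM2l// ler_wpM2l ?ltW.
have [x [y [x' [y' [Ax By Ax' By' xy]]]]] :=
  beta_iso e20 mA mB mA' mB' (key _ kAB) (key _ kAB').
exists x, y, x', y'; split => //.
by apply: le_trans xy _; rewrite mulrC divfK.
Qed.

(** [Y] is quantified after [rel], because the space in which the measures are compared is built
    from these relations. The number [v] is the common value on [C] of the two marginals. *)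
Lemma limit_isometry : exists rel : X1 -> X2 -> Prop,
  [/\ exists x y, rel x y,
      forall x y x' y', rel x y -> rel x' y' -> mdist x x' = mdist y y' &
      forall (Y : polishMetricType R) (iota1 : isometric_embedding X1 Y)
        (iota2 : isometric_embedding X2 Y),
      (forall x y, rel x y -> iota1 x = iota2 y) ->
      forall C : set (borel Y), measurable C ->
      exists v, forall a, 0 < a ->
        slope a * (v - a * fine (mu1 (iota1 @^-1` C))) <= delta /\
        slope a * (v - a * fine (mu2 (iota2 @^-1` C))) <= delta].
Proof.
have [beta [betaP biso]] := bim_limit.
(* The support is empty when the limit coupling is zero; one arbitrary pair then keeps [rel]
   nonempty, as gluing requires. *)
pose triv (x : X1) (y : X2) := x = point /\ y = point.
pose rel x y := bim_support beta x y \/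
  (~ (exists x y, bim_support beta x y) /\ triv x y).
exists rel; split.
- have [[x [y xy]]|nex] := pselect (exists x y, bim_support beta x y).
    by exists x, y; left.
  by exists point, point; right.
- move=> x y x' y' [xy|[nex [-> ->]]] [xy'|[nex' [-> ->]]]; rewrite ?mdistxx//.
  + exact: (bim_support_isometric biso).
  + by exfalso; apply: nex'; exists x, y.
  + by exfalso; apply: nex; exists x', y'.
- move=> Y iota1 iota2 agree C mC.
  have mpre (X : polishMetricType R) (iota : isometric_embedding X Y) :
      measurable (iota @^-1` C : set (borel X)).
    exact: (preimage_borel (@embedding_continuous _ _ _ iota) mC).
  exists (beta (iota1 @^-1` C) setT) => a a0; split.
    exact: (bim_doml betaP).
  have agree' x y : bim_support beta x y -> iota1 x = iota2 y.
    by move=> xy; apply: agree; left.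
  rewrite (bim_agreement betaP biso slope_unbounded agree' mC).
  exact: (bim_domr betaP).
Qed.

End limit_isometry.

(** * The entropy functions and their divergences *)

Section power_entropy.
Context {R : realType} (p : R).
Hypothesis p1 : 1 <= p.

(** The derivative of [power_entropy p] at [a]; it changes sign at 1. *)
Definition entropy_slope (a : R) : R :=
  if p == 1 then ln a else (a `^ (p - 1) - 1) / (p - 1).

(** Young's inequality for [u] and 1. *)
Let powR_bernoulli (q u : R) : 1 < q -> 0 <= u -> q * (u - 1) + 1 <= u `^ q.
Proof.
move=> q1 u0; have q0 : 0 < q by lra.
have q10 : 0 < q - 1 by lra.
have qn0 : q != 0 by rewrite gt_eqF.
have q1n0 : q - 1 != 0 by rewrite gt_eqF.
have := @conjugate_powR R u 1 q (q / (q - 1)) u0 ler01 q0 (divr_gt0 q0 q10).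
have -> : q^-1 + (q / (q - 1))^-1 = 1 by field; rewrite ?qn0 ?q1n0.
move=> /(_ erefl); rewrite powR1 mulr1 -(ler_pM2l q0) mulrDr.
have -> : q * (u `^ q / q) = u `^ q by field.
have -> : q * (1 / (q / (q - 1))) = q - 1 by field; rewrite ?qn0 ?q1n0.
lra.
Qed.

(** Convexity, after dropping from the tangent at [a] the constant U_p(a), which is nonnegative. *)
Lemma power_entropy_ge_tangent (a s : R) : 0 < a -> 0 <= s ->
  entropy_slope a * (s - a) <= power_entropy p s.
Proof.
move=> a0 s0; rewrite /entropy_slope /power_entropy.
have [_|pn1] := eqVneq p 1.
  have ln_le (x : R) : 0 < x -> ln x <= x - 1.
    move=> x0; have := @le_ln1Dx R (x - 1).
    by rewrite (_ : 1 + (x - 1) = x); [apply; lra|ring].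
  have := ln_le a^-1; rewrite invr_gt0 lnV ?posrE// lerNl opprB => /(_ a0) la.
  (* This is U_1(a) >= 0. *)
  have aa : a * (1 - a^-1) <= a * ln a by rewrite ler_wpM2l// ltW.
  rewrite mulrBr mulr1 divff ?gt_eqF// in aa.
  move: s0; rewrite le_eqVlt => /predU1P[<-|s0]; first by nra.
  have := ln_le (a / s); rewrite divr_gt0// ln_div ?posrE// => /(_ isT) las.
  have : s * (ln a - ln s) <= s * (a / s - 1) by rewrite ler_wpM2l// ltW.
  have -> : s * (a / s - 1) = a - s by field; rewrite gt_eqF.
  nra.
have pgt1 : 1 < p by rewrite lt_neqAle eq_sym pn1.
have p0 : 0 < p by lra.
have p10 : 0 < p - 1 by lra.
rewrite ler_pdivlMr ?mulr_gt0//.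
have -> : (a `^ (p - 1) - 1) / (p - 1) * (s - a) * (p * (p - 1)) =
  p * (a `^ (p - 1) - 1) * (s - a) by field; rewrite gt_eqF.
have ap : a `^ p = a * a `^ (p - 1).
  have := @powRD R a (p - 1) 1; rewrite subrK powRr1 ?ltW// (gt_eqF p0).
  by move=> /(_ isT) ->; rewrite mulrC.
have sa0 : 0 <= s / a by rewrite divr_ge0// ltW.
have := powR_bernoulli pgt1 sa0.
rewrite -(ler_pM2l (powR_gt0 p a0)) -(powRM p (ltW a0) sa0).
have -> : a * (s / a) = s by field; rewrite gt_eqF.
have -> : a `^ p * (p * (s / a - 1) + 1) =
    p * s * a `^ (p - 1) - (p - 1) * (a * a `^ (p - 1)).
  by rewrite ap; field; rewrite gt_eqF.
(* Bernoulli at s / a gave the tangent inequality; at [a] it says that U_p(a) is nonnegative. *)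
have := powR_bernoulli pgt1 (ltW a0); rewrite ap.
set t := a `^ (p - 1); nra.
Qed.

(** Reduces unboundedness and positivity of the slope to those of the logarithm, through exp t >= 1
    + t with t = (p - 1) ln a. *)
Lemma entropy_slope_ge_ln (a : R) : 0 < a -> ln a <= entropy_slope a.
Proof.
move=> a0; rewrite /entropy_slope; have [//|pn1] := eqVneq p 1.
have p10 : 0 < p - 1 by rewrite subr_gt0 lt_neqAle eq_sym pn1.
rewrite ler_pdivlMr// mulrC lerBrDl /powR gt_eqF//.
exact: expR_ge1Dx.
Qed.

Lemma entropy_slope_unbounded (t : R) : exists2 a, 0 < a & t <= entropy_slope a.
Proof.
exists (expR t); first exact: expR_gt0.
by rewrite -{1}(expRK t) entropy_slope_ge_ln// expR_gt0.
Qed.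

Lemma entropy_slope_gt0 (a : R) : 1 < a -> 0 < entropy_slope a.
Proof.
by move=> a1; apply: lt_le_trans (entropy_slope_ge_ln (lt_trans ltr01 a1));
  exact: ln_gt0.
Qed.

Lemma entropy_slope_lt0 (a : R) : 0 < a < 1 -> entropy_slope a < 0.
Proof.
move=> /andP[a0 a1]; rewrite /entropy_slope; have la : ln a < 0 by rewrite ln_lt0// a0.
have [//|pn1] := eqVneq p 1.
have p10 : 0 < p - 1 by rewrite subr_gt0 lt_neqAle eq_sym pn1.
rewrite pmulr_llt0 ?invr_gt0// subr_lt0 /powR gt_eqF// expR_lt1.
by rewrite pmulr_rlt0.
Qed.

Lemma power_entropy_ge0 (s : R) : 0 <= s -> 0 <= power_entropy p s.
Proof.
move=> s0; have := @power_entropy_ge_tangent 1 s ltr01 s0.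
by rewrite /entropy_slope ln1 powR1 subrr !mul0r if_same mul0r.
Qed.

(** By convexity U_p lies below its chord from 1 / p at 0 to 0 at 1, and 1 / p <= 1. *)
Lemma power_entropy_le_id (s : R) : 0 <= s <= 1 -> power_entropy p s <= 1 - s.
Proof.
move=> /andP[s0 s1]; rewrite /power_entropy; have [_|pn1] := eqVneq p 1.
  have : s * ln s <= 0 by rewrite mulr_ge0_le0// ln_le0.
  lra.
have pgt1 : 1 < p by rewrite lt_neqAle eq_sym pn1.
have ps : s `^ p <= s.
  move: s0; rewrite le_eqVlt => /predU1P[<-|s0]; first by rewrite powR0//; lra.
  by rewrite ge1r_powR ?s0// ltW.
rewrite ler_pdivrMr; last by rewrite mulr_gt0; lra.
have : 0 <= (p - 1) * (p - 1) * (1 - s) by rewrite !mulr_ge0//; lra.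
nra.
Qed.

Lemma measurable_power_entropy : measurable_fun [set: R] (power_entropy p).
Proof.
rewrite /power_entropy; have [_|pn1] := eqVneq p 1.
  apply: measurable_funD => //; apply: measurable_funB => //.
  exact: measurable_funM.
apply: measurable_funM => //; apply: measurable_funB => //.
apply: measurable_funB => //; apply: measurable_funM => //.
exact: measurable_funB.
Qed.

End power_entropy.

Local Open Scope ereal_scope.

Section density.
Context {R : realType} {T : ptopologicalType} (gamma mu : borel_measure R T).
Hypothesis gamma_mu : gamma `<< mu.

(** Trades the Radon-Nikodym derivative in [divergence], controlled only almost everywhere, for a
    density that is finite and nonnegative everywhere. *)
Lemma finite_density : exists g : borel T -> R,
  [/\ measurable_fun setT g, forall x, (0 <= g x)%R,
      mu.-integrable setT (EFin \o g),
      forall A, measurable A -> gamma A = \int[mu]_(x in A) (g x)%:E &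
      forall F : R -> R, measurable_fun setT F ->
        divergence (fun s => (F s)%:E) gamma mu = \int[mu]_x (F (g x))%:E].
Proof.
pose f := Radon_Nikodym_SigmaFinite.f gamma mu.
have f0 x : 0 <= f x by exact: Radon_Nikodym_SigmaFinite.f_ge0.
have ffin x : f x \is a fin_num by exact: Radon_Nikodym_SigmaFinite.f_fin_num.
have fint : mu.-integrable setT f by exact: Radon_Nikodym_SigmaFinite.f_integrable.
have fE : f = EFin \o (fine \o f) by apply/funext => x /=; rewrite fineK.
have mf : measurable_fun setT f by exact: measurable_int fint.
have mg : measurable_fun setT (fine \o f) by exact: measurableT_comp.
exists (fine \o f); split => //.
- by move=> x; exact: fine_ge0.
- by rewrite -fE.
- move=> A mA; rewrite (Radon_Nikodym_SigmaFinite.f_integral gamma_mu mA).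
  by apply: eq_integral => x _; rewrite /= fineK.
- move=> F mF; rewrite /divergence asboolT//; apply: ae_eq_integral => //.
  + apply/measurable_EFinP; apply: measurableT_comp => //.
    exact: measurableT_comp.
  + by apply/measurable_EFinP; apply: measurableT_comp.
  + have := ae_eq_Radon_Nikodym_SigmaFinite gamma_mu measurableT.
    by apply: filterS => x /= h xT; rewrite -h.
Qed.

End density.

Lemma divergence_ge0 (R : realType) (T : ptopologicalType) (p : R)
    (gamma mu : borel_measure R T) : (1 <= p)%R ->
  0 <= divergence (fun s => (power_entropy p s)%:E) gamma mu.
Proof.
move=> p1; have [gm|ngm] := pselect (gamma `<< mu); last first.
  by rewrite /divergence asboolF.
have [g [mg g0 _ _ ->]] := finite_density gm; last exact: measurable_power_entropy.
by apply: integral_ge0 => x _; rewrite lee_fin power_entropy_ge0.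
Qed.

Lemma divergence_dominates (R : realType) (T : ptopologicalType) (F : R -> \bar R)
  (gamma mu : borel_measure R T) : divergence F gamma mu < +oo -> gamma `<< mu.
Proof. by rewrite /divergence; case: ifPn => // /asboolP. Qed.

(** The pointwise tangent inequality, applied to the density and integrated over [A]; outside [A]
    the entropy is nonnegative. *)
Lemma divergence_slope (R : realType) (T : ptopologicalType) (p delta : R)
    (gamma mu : borel_measure R T) : (1 <= p)%R ->
  divergence (fun s => (power_entropy p s)%:E) gamma mu <= delta%:E ->
  forall a A, (0 < a)%R -> measurable A ->
  (entropy_slope p a * (fine (gamma A) - a * fine (mu A)) <= delta)%R.
Proof.
move=> p1 D a A a0 mA.
have gm : gamma `<< mu.
  by apply: (@divergence_dominates R T); apply: le_lt_trans D _; rewrite ltry.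
have [g [mg g0 ig gA Dg]] := finite_density gm.
rewrite Dg in D; last exact: measurable_power_entropy.
have mFg : measurable_fun setT (EFin \o (power_entropy p \o g)).
  by apply/measurable_EFinP; apply: measurableT_comp mg; exact: measurable_power_entropy.
have Fg0 x : 0 <= (power_entropy p (g x))%:E by rewrite lee_fin power_entropy_ge0.
have iFg : mu.-integrable setT (EFin \o (power_entropy p \o g)).
  apply/integrableP; split => //.
  have -> : \int[mu]_x `|(EFin \o (power_entropy p \o g)) x| =
      \int[mu]_x (power_entropy p (g x))%:E.
    by apply: eq_integral => x _; exact: gee0_abs (Fg0 x).
  by apply: le_lt_trans D _; rewrite ltry.
have ic : mu.-integrable A (EFin \o cst a) by exact: finite_measure_integrable_cst.
have igA : mu.-integrable A (EFin \o g) by exact: integrableS ig.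
rewrite -lee_fin; apply: le_trans D.
apply: (@le_trans _ _ (\int[mu]_(x in A) (power_entropy p (g x))%:E)); last first.
  by apply: ge0_subset_integral.
have -> : (entropy_slope p a * (fine (gamma A) - a * fine (mu A)))%:E =
    \int[mu]_(x in A) ((entropy_slope p a)%:E * ((g x)%:E - a%:E)).
  rewrite integralZl//; last exact: integrableB.
  rewrite integralB// -gA// integral_cst// EFinM EFinB EFinM !fineK//.
  - exact: fin_num_measure.
  - exact: fin_num_measure.
apply: le_integral => //.
- by apply: integrableZl => //; exact: integrableB.
- exact: integrableS iFg.
- by move=> x _; rewrite lee_fin power_entropy_ge_tangent.
Qed.

(** * From entropy-transport plans to couplings *)

Lemma closed_mdist (R : realType) (X : metricType R) (C : set X) (x : X) :
  closed C -> (forall e : R, (0 < e)%R -> exists2 a, C a & (mdist x a < e)%R) -> C x.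
Proof.
move=> cC h; apply: cC => U /metricType_numDomainType.nbhs_mdistP [e /= e0 eU].
by have [a Ca xa] := h e e0; exists a; split => //; exact: eU.
Qed.

Lemma isometric_embedding_inj (R : realType) (X Y : metricType R)
  (f : isometric_embedding X Y) : injective f.
Proof.
move=> x y fxy; apply: mdist_positivity.
by rewrite -(embedding_isometry f) fxy mdistxx.
Qed.

(** * Borel images under an embedding of the support *)

Section support_image.
Context {R : realType} {X Y : polishMetricType R} (mu : borel_measure R X).

(** By separability the complement is covered by countably many null open sets of the base. *)
Lemma measure_setC_support : mu (~` Defs.support mu) = 0.
Proof.
have [V [oV VP]] := countable_base X.
pose W k : set (borel X) := if mu (V k) == 0 then V k else set0.
have mV k : measurable (V k : set (borel X)) by exact: open_borel.
have mW k : measurable (W k) by rewrite /W; case: ifP.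
have W0 : mu.-negligible (\bigcup_k W k).
  apply: negligible_bigcup => k; apply/negligibleP => //.
  by rewrite /W; case: ifPn => [/eqP//|_]; rewrite measure0.
have mC : measurable (~` Defs.support mu : set (borel X)).
  by apply: measurableC; exact: measurable_support.
apply/negligibleP => //; apply: negligibleS W0 => x /= sx.
have [U [oU Ux U0]] : exists U, [/\ open U, U x & mu U = 0].
  apply: contrapT => h; apply: sx => U oU Ux; rewrite lt0e measure_ge0 andbT.
  by apply/eqP => U0; apply: h; exists U.
have [k [Vkx VkU]] := VP U x oU Ux; exists k => //.
rewrite /W ifT//; rewrite -measure_le0 -U0 le_measure ?inE//.
exact: open_borel.
Qed.

Lemma measureI_support (A : set (borel X)) : measurable A ->
  mu (A `&` Defs.support mu) = mu A.
Proof.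
move=> mA; have mS := measurable_support mu.
rewrite [RHS](measureDI mu mA mS) [X in X + _](_ : _ = 0) ?add0e//.
apply/eqP; rewrite -measure_le0 -measure_setC_support le_measure ?inE//.
- exact: measurableD.
- exact: measurableC.
Qed.

Context (psi : isometric_embedding (Defs.support mu) Y).

(** Plans live on [Y], while the couplings to be compared live on the original spaces; Borel sets
    must therefore be pushed forward, not pulled back. *)
Definition simage (A : set (borel X)) : set (borel Y) :=
  psi @` (set_val @^-1` A).

Lemma simageC (A : set (borel X)) : simage (~` A) = simage setT `\` simage A.
Proof.
apply/seteqP; split => [_ [x Ax <-]|y [[x _ <-] nAx]].
  split; first by exists x.
  by move=> [x' Ax' /isometric_embedding_inj xx']; apply: Ax; rewrite -xx'.
by exists x => // Ax; apply: nAx; exists x.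
Qed.

Lemma simage_bigcup (F : (set (borel X))^nat) :
  simage (\bigcup_n F n) = \bigcup_n simage (F n).
Proof. by rewrite /simage preimage_bigcup image_bigcup. Qed.

(** Preimages of a convergent sequence form a Cauchy sequence, whose limit stays in [C] and in the
    support, both closed. This makes Borel images Borel by an elementary sigma-algebra argument. *)
Lemma closed_simage (C : set X) : closed C -> closed (simage C).
Proof.
move=> cC y cly.
have /choice [u uP] n : exists a : Defs.support mu, C (set_val a) /\
    (mdist (psi a) y < n.+1%:R^-1)%R.
  have n0 : (0 < n.+1%:R^-1 :> R)%R by rewrite invr_gt0.
  have [_ [[a Ca <-]]] := cly _ (nbhsx_ballx y _ n0).
  by rewrite ballEmdist /= metric_sym => ay; exists a.
have uE m n : mdist (set_val (u m)) (set_val (u n)) = mdist (psi (u m)) (psi (u n)).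
  by rewrite embedding_isometry.
have [|x xP] := @cauchy_sequence_cvg R X (fun n => set_val (u n)).
  move=> m n; rewrite uE; apply: le_trans (metric_triangle _ y _) _.
  rewrite (metric_sym y); apply: lerD; apply: ltW; first by have [] := uP m.
  by have [] := uP n.
have cl (D : set X) : closed D -> (forall n, D (set_val (u n))) -> D x.
  move=> cD Du; apply: closed_mdist => // e e0.
  have [n nP] := natSinv_lt e0; exists (set_val (u n)) => //.
  by rewrite metric_sym; apply: le_lt_trans (xP n) _; exact: nP.
have sx : Defs.support mu x.
  by apply: cl; [exact: closed_support|move=> n; exact: set_valP].
have Cx : C x by apply: cl => // n; have [] := uP n.
pose x' : Defs.support mu := exist _ x (mem_set sx).
have ux n : (mdist (u n) x' <= n.+1%:R^-1)%R := xP n.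
exists x' => //; apply: mdist_positivity; apply/eqP.
rewrite eq_le mdist_ge0 andbT; apply/ler_addgt0Pl => e e0; rewrite addr0.
have [n nP] := natSinv_lt (divr_gt0 e0 (ltr0n R 2)).
apply: le_trans (metric_triangle _ (psi (u n)) _) _.
rewrite embedding_isometry (metric_sym x'); have [_] := uP n; have := ux n.
have := nP n (leqnn n).
set q := (n.+1%:R^-1)%R; lra.
Qed.

Lemma measurable_simage (A : set (borel X)) :
  measurable A -> measurable (simage A).
Proof.
have mT : measurable (simage setT).
  by apply: closed_borel; apply: closed_simage; exact: closedT.
suff : <<s @open X >> `<=` [set A : set (borel X) | measurable (simage A)] by exact.
apply: smallest_sub => [|U oU].
  split => /= [|B mB|F mF].
  - by rewrite /simage preimage_set0 image_set0.
  - by rewrite setTD simageC; apply: measurableD.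
  - by rewrite simage_bigcup; exact: bigcupT_measurable.
rewrite /= -[U]setCK simageC; apply: measurableD => //; apply: closed_borel.
by apply: closed_simage; exact: open_closedC.
Qed.

Lemma spushforward_simage (A : set (borel X)) : measurable A ->
  spushforward psi (simage A) = mu A.
Proof.
move=> mA; rewrite /spushforward /= -(measureI_support mA); congr (mu _).
apply/seteqP; split => [_ [x [x' Ax' /isometric_embedding_inj xx'] <-]|x [Ax sx]].
  by rewrite -xx'; split => //; exact: set_valP.
by exists (exist _ x (mem_set sx)) => //; exists (exist _ x (mem_set sx)).
Qed.

Lemma spushforward_simageC : spushforward psi (~` simage setT) = 0.
Proof.
rewrite /spushforward /= (_ : spreimage psi _ = set0) ?measure0//.
rewrite -subset0 => z [x nx _]; apply: nx; by exists x.
Qed.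

End support_image.

Lemma measurable_mdist (R : realType) (Y : polishMetricType R) :
  measurable_fun [set: borel (Y * Y)%type]
  (fun z : borel (Y * Y)%type => mdist z.1 z.2 : R).
Proof.
have cm : continuous (fun z : (Y * Y)%type => mdist z.1 z.2 : R).
  move=> [x y]; apply/cvgrPdist_lt => e e0 /=.
  have e20 : (0 < e / 2)%R by rewrite divr_gt0.
  exists (ball x (e / 2), ball y (e / 2)); first by split; exact: nbhsx_ballx.
  move=> [x' y'] [/=]; rewrite !ballEmdist /= => xx' yy'.
  rewrite ltr_norml; have := metric_triangle x x' y; have := metric_triangle x' y' y.
  have := metric_triangle x' x y'; have := metric_triangle x y y'.
  by rewrite (metric_sym x' x) (metric_sym y' y); move=> *; apply/andP; split; lra.
apply: (measurability _ (RGenOpens.measurableE R)).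
move=> _ [_ [a [b ->]] <-]; rewrite setTI; apply: open_borel.
by move/continuousP: cm; apply; exact: interval_open.
Qed.

Section coupling.
Context {R : realType} (p delta : R) (k : nat).
Hypothesis p1 : (1 <= p)%R.
Context (X1 X2 Y : polishMetricType R).
Context (mu1 : borel_measure R X1) (mu2 : borel_measure R X2).
Context (psi1 : isometric_embedding (Defs.support mu1) Y).
Context (psi2 : isometric_embedding (Defs.support mu2) Y).
Context (gamma : borel_measure R (Y * Y)%type).
Let F : R -> \bar R := fun s => (power_entropy p s)%:E.
Hypothesis gamma1 : divergence F
  (cpushforward (@fst_continuous Y Y) gamma) (spushforward psi1) <= delta%:E.
Hypothesis gamma2 : divergence F
  (cpushforward (@snd_continuous Y Y) gamma) (spushforward psi2) <= delta%:E.
Hypothesis gamma_cost :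
  \int[gamma]_z (k%:R * mdist z.1 z.2)%:E <= delta%:E.

Definition coupling_bimeasure (A : set (borel X1)) (B : set (borel X2)) : R :=
  fine (gamma (simage psi1 A `*` simage psi2 B)).

Let mX A B : measurable A -> measurable B ->
  measurable (simage psi1 A `*` simage psi2 B : set (borel (Y * Y)%type)).
Proof. by move=> mA mB; apply: borelX; exact: measurable_simage. Qed.

Let simage_disjoint (X : polishMetricType R) (mu : borel_measure R X)
  (psi : isometric_embedding (Defs.support mu) Y) (A A' : set (borel X)) :
  A `&` A' = set0 -> simage psi A `&` simage psi A' = set0.
Proof.
move=> AA'; rewrite -subset0 => _ [[x Ax <-] [x' Ax' /isometric_embedding_inj xx']].
by have : (A `&` A') (set_val x); [split => //; rewrite -xx'|rewrite AA'].
Qed.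

Let simageU (X : polishMetricType R) (mu : borel_measure R X)
  (psi : isometric_embedding (Defs.support mu) Y) (A A' : set (borel X)) :
  simage psi (A `|` A') = simage psi A `|` simage psi A'.
Proof. by rewrite /simage preimage_setU image_setU. Qed.

(** The second marginal is absolutely continuous with respect to a measure carried by the image of
    the support of [mu2], so restricting the second coordinate to that image loses no mass. *)
Let gamma_fst A : measurable A ->
  gamma (simage psi1 A `*` simage psi2 setT) =
  cpushforward (@fst_continuous Y Y) gamma (simage psi1 A).
Proof.
move=> mA; have mA1 := measurable_simage psi1 mA.
have mT2 := measurable_simage psi2 measurableT.
have m1 := borelX mA1 (@measurableT _ (borel Y)); have m2 := borelX mA1 mT2.
have /null_content_dominatesP dom :
    cpushforward (@snd_continuous Y Y) gamma `<< spushforward psi2.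
  by apply: (@divergence_dominates R Y F); apply: le_lt_trans gamma2 _; rewrite ltry.
have := dom _ (measurableC mT2) (spushforward_simageC psi2).
rewrite /cpushforward /pushforward => g0.
rewrite /cpushforward /pushforward -setXT (measureDI gamma m1 m2).
rewrite [X in _ = X + _](_ : _ = 0) ?add0e; last first.
  apply/eqP; rewrite -measure_le0 -g0 le_measure ?inE//.
  - exact: measurableD.
  - exact: (preimage_borel (@snd_continuous Y Y) (measurableC mT2)).
  - by move=> [u v] [[/= Au _] nAu] Tv; apply: nAu.
by congr (gamma _); rewrite setIC; apply/esym/setIidl => -[u v] [].
Qed.

Let gamma_snd B : measurable B ->
  gamma (simage psi1 setT `*` simage psi2 B) =
  cpushforward (@snd_continuous Y Y) gamma (simage psi2 B).
Proof.
move=> mB; have mB2 := measurable_simage psi2 mB.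
have mT1 := measurable_simage psi1 measurableT.
have m1 := borelX (@measurableT _ (borel Y)) mB2; have m2 := borelX mT1 mB2.
have /null_content_dominatesP dom :
    cpushforward (@fst_continuous Y Y) gamma `<< spushforward psi1.
  by apply: (@divergence_dominates R Y F); apply: le_lt_trans gamma1 _; rewrite ltry.
have := dom _ (measurableC mT1) (spushforward_simageC psi1).
rewrite /cpushforward /pushforward => g0.
rewrite /cpushforward /pushforward -setTX (measureDI gamma m1 m2).
rewrite [X in _ = X + _](_ : _ = 0) ?add0e; last first.
  apply/eqP; rewrite -measure_le0 -g0 le_measure ?inE//.
  - exact: measurableD.
  - exact: (preimage_borel (@fst_continuous Y Y) (measurableC mT1)).
  - by move=> [u v] [[/= _ Bv] nAu] Tu; apply: nAu.
by congr (gamma _); rewrite setIC; apply/esym/setIidl => -[u v] [].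
Qed.

Lemma coupling_bimeasure_dominated :
  dominated_bimeasure (entropy_slope p) delta mu1 mu2 coupling_bimeasure.
Proof.
split.
- by move=> A B mA mB; exact: fine_ge0.
- move=> A A' B mA mA' mB AA'.
  rewrite /coupling_bimeasure simageU.
  rewrite -fineD ?fin_num_measure//; try exact: mX.
  rewrite -measureU; try exact: mX; last first.
    rewrite -subset0 => -[u v] [[/= Au _] [/= A'u _]].
    by have := simage_disjoint psi1 AA'; rewrite -subset0; apply; split; [exact: Au|].
  congr (fine (gamma _)); apply/seteqP.
  split => [[u v] /= [[Au|Au] Bv]|[u v] /= [[Au Bv]|[Au Bv]]];
    by [left|right|split => //; left|split => //; right].
- move=> A B B' mA mB mB' BB'.
  rewrite /coupling_bimeasure simageU.
  rewrite -fineD ?fin_num_measure//; try exact: mX.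
  rewrite -measureU; try exact: mX; last first.
    rewrite -subset0 => -[u v] [[/= _ Bv] [/= _ B'v]].
    by have := simage_disjoint psi2 BB'; rewrite -subset0; apply; split; [exact: Bv|].
  congr (fine (gamma _)); apply/seteqP.
  split => [[u v] /= [Au [Bv|Bv]]|[u v] /= [[Au Bv]|[Au Bv]]];
    by [left|right|split => //; left|split => //; right].
- move=> a A a0 mA; rewrite /coupling_bimeasure gamma_fst//.
  rewrite -(spushforward_simage psi1 mA).
  exact: (divergence_slope p1 gamma1 a0 (measurable_simage psi1 mA)).
- move=> a B a0 mB; rewrite /coupling_bimeasure gamma_snd//.
  rewrite -(spushforward_simage psi2 mB).
  exact: (divergence_slope p1 gamma2 a0 (measurable_simage psi2 mB)).
Qed.

(** Chebyshev's inequality: if all pairs of the rectangle were at distance at least [e], its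
    contribution to the cost would be at least k e times its mass. *)
Lemma coupling_near (A : set (borel X1)) (B : set (borel X2)) (e : R) :
  (0 < e)%R -> measurable A -> measurable B ->
  (delta < k%:R * e * coupling_bimeasure A B)%R ->
  exists x y, [/\ A (set_val x), B (set_val y) & (mdist (psi1 x) (psi2 y) < e)%R].
Proof.
move=> e0 mA mB dAB; apply: contrapT => far; move: dAB; apply/negP.
rewrite -leNgt -lee_fin.
apply: le_trans gamma_cost; rewrite EFinM fineK; last first.
  by rewrite fin_num_measure//; exact: mX.
have mS := mX mA mB.
rewrite -integral_cst//.
apply: (@le_trans _ _ (\int[gamma]_(z in simage psi1 A `*` simage psi2 B)
    (k%:R * mdist z.1 z.2)%:E)).
  apply: ge0_le_integral => //.
  - by move=> z _; rewrite lee_fin mulr_ge0// ltW.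
  - apply/measurable_EFinP; apply: measurable_funM => //.
    by apply: measurable_funTS; exact: measurable_mdist.
  - move=> [u v] [/= [x Ax <-] [y By <-]]; rewrite lee_fin ler_wpM2l//.
    by rewrite leNgt; apply/negP => xy; apply: far; exists x, y.
apply: ge0_subset_integral => //.
- by apply/measurable_EFinP; apply: measurable_funM => //; exact: measurable_mdist.
- by move=> z _; rewrite lee_fin mulr_ge0// mdist_ge0.
Qed.

Lemma coupling_bimeasure_isometric (e : R) A B A' B' : (0 < e)%R ->
  measurable A -> measurable B -> measurable A' -> measurable B' ->
  (delta < k%:R * e * coupling_bimeasure A B)%R ->
  (delta < k%:R * e * coupling_bimeasure A' B')%R ->
  exists (x : X1) (y : X2) (x' : X1) (y' : X2),
    [/\ A x, B y, A' x', B' y' & (`|mdist x x' - mdist y y'| <= 2 * e)%R].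
Proof.
move=> e0 mA mB mA' mB' /(coupling_near e0 mA mB) [x [y [Ax By xy]]].
move=> /(coupling_near e0 mA' mB') [x' [y' [Ax' By' xy']]].
exists (set_val x), (set_val y), (set_val x'), (set_val y'); split => //.
have -> : mdist (set_val x) (set_val x') = mdist (psi1 x) (psi1 x').
  by rewrite embedding_isometry.
have -> : mdist (set_val y) (set_val y') = mdist (psi2 y) (psi2 y').
  by rewrite embedding_isometry.
move: (psi1 x) (psi1 x') (psi2 y) (psi2 y') xy xy' => a a' b b' ab ab'.
rewrite ler_norml; have := metric_triangle a b a'; have := metric_triangle b b' a'.
have := metric_triangle b a b'; have := metric_triangle a a' b'.
by rewrite (metric_sym b a) (metric_sym b' a'); move=> *; apply/andP; split; lra.
Qed.

End coupling.

(** * Plans and isometries obtained from a bound on PL *)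

Section PL_coupling.
Context {R : realType} (p : R).
Hypothesis p1 : (1 <= p)%R.

Local Notation F := (fun s : R => (power_entropy p s)%:E).
Local Notation cost n := (fun z => (n%:R * mdist z.1 z.2)%:E).

Let cost_ge0 (Y : polishMetricType R) n (gamma : borel_measure R (Y * Y)%type) :
  0 <= \int[gamma]_z cost n z.
Proof. by apply: integral_ge0 => z _; rewrite lee_fin mulr_ge0// mdist_ge0. Qed.

Lemma entropy_transport_ge0 (Y : polishMetricType R) n (mu1 mu2 : borel_measure R Y) :
  0 <= entropy_transport F (cost n) mu1 mu2.
Proof.
apply: le_ereal_inf_tmp => _ [gamma _ <-].
by apply: adde_ge0 => //; apply: adde_ge0; exact: divergence_ge0.
Qed.

Lemma ET_dist_nondecreasing (Y : polishMetricType R) (mu1 mu2 : borel_measure R Y) :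
  {homo (fun n => ET_dist p n mu1 mu2) : m n / (m <= n)%N >-> m <= n}.
Proof.
move=> m n mn; rewrite /ET_dist lee_sqrt; last exact: entropy_transport_ge0.
apply: le_ereal_inf_tmp => _ [gamma _ <-]; apply: ge_ereal_inf.
eexists; first by exists gamma.
rewrite leeD2l//; apply: ge0_le_integral => //.
- by move=> z _; rewrite lee_fin mulr_ge0// mdist_ge0.
- by apply/measurable_EFinP; apply: measurable_funM => //; exact: measurable_mdist.
- by apply/measurable_EFinP; apply: measurable_funM => //; exact: measurable_mdist.
- by move=> z _; rewrite lee_fin ler_wpM2r ?mdist_ge0// ler_nat.
Qed.

Lemma mm_ET_dist_nondecreasing (X1 X2 : mmspace R) :
  nondecreasing_seq (fun n => mm_ET_dist p n X1 X2).
Proof.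
move=> m n mn; apply: le_ereal_inf_tmp => _ [Y [psi1 [psi2 ->]]].
apply: ge_ereal_inf; eexists; first by exists Y, psi1, psi2.
exact: ET_dist_nondecreasing.
Qed.

Lemma mm_ET_dist_le_PL (X1 X2 : mmspace R) n : mm_ET_dist p n X1 X2 <= PL p X1 X2.
Proof.
have := ereal_nondecreasing_cvgn (@mm_ET_dist_nondecreasing X1 X2).
by rewrite /PL => /cvg_lim ->//; apply: ereal_sup_ubound; exists n.
Qed.

Lemma PL_ge0 (X1 X2 : mmspace R) : 0 <= PL p X1 X2.
Proof.
apply: le_trans (mm_ET_dist_le_PL X1 X2 0); apply: le_ereal_inf_tmp.
by move=> _ [Y [psi1 [psi2 ->]]]; exact: sqrte_ge0.
Qed.

(** PL dominates every level [k], and strictness turns the two infima into an actual plan of total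
    cost below r^2. Its three terms are nonnegative, so each obeys this bound. *)
Lemma PL_coupling (X1 X2 : mmspace R) (r : R) k : PL p X1 X2 < r%:E ->
  exists (Y : polishMetricType R)
    (psi1 : isometric_embedding (Defs.support (mm_measure X1)) Y)
    (psi2 : isometric_embedding (Defs.support (mm_measure X2)) Y)
    (gamma : borel_measure R (Y * Y)%type),
  [/\ divergence F (cpushforward (@fst_continuous Y Y) gamma)
        (spushforward psi1) <= (r ^+ 2)%:E,
      divergence F (cpushforward (@snd_continuous Y Y) gamma)
        (spushforward psi2) <= (r ^+ 2)%:E &
      \int[gamma]_z cost k z <= (r ^+ 2)%:E].
Proof.
move=> /(le_lt_trans (mm_ET_dist_le_PL X1 X2 k)) /ereal_inf_lt [_ [Y [psi1 [psi2 ->]]]].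
rewrite /ET_dist; set E := entropy_transport _ _ _ _ => Er.
have E0 : 0 <= E by exact: entropy_transport_ge0.
have {Er E0} : E < (r ^+ 2)%:E.
  move: E E0 Er => [e| |]//=; rewrite !lte_fin lee_fin => e0 er.
  rewrite -(sqr_sqrtr e0) ltr_pXn2r// nnegrE ?sqrtr_ge0//.
  by apply: ltW; apply: le_lt_trans er; exact: sqrtr_ge0.
move=> /ereal_inf_lt [_ [gamma _ <-]] lt_r.
exists Y, psi1, psi2, gamma.
have D1 := divergence_ge0 (cpushforward (@fst_continuous Y Y) gamma)
  (spushforward psi1) p1.
have D2 := divergence_ge0 (cpushforward (@snd_continuous Y Y) gamma)
  (spushforward psi2) p1.
have C := cost_ge0 k gamma.
split; apply: le_trans (ltW lt_r).
- by rewrite -addeA leeDl// adde_ge0.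
- by rewrite addeAC leeDr// adde_ge0.
- by rewrite leeDr// adde_ge0.
Qed.

Lemma PL_isometry (X1 X2 : mmspace R) (r : R) : PL p X1 X2 < r%:E ->
  exists rel : X1 -> X2 -> Prop,
  [/\ exists x y, rel x y,
      forall x y x' y', rel x y -> rel x' y' -> mdist x x' = mdist y y' &
      forall (Y : polishMetricType R) (iota1 : isometric_embedding X1 Y)
        (iota2 : isometric_embedding X2 Y),
      (forall x y, rel x y -> iota1 x = iota2 y) ->
      forall C : set (borel Y), measurable C ->
      exists v, forall a, (0 < a)%R ->
        (entropy_slope p a *
          (v - a * fine (mm_measure X1 (iota1 @^-1` C))) <= r ^+ 2)%R /\
        (entropy_slope p a *
          (v - a * fine (mm_measure X2 (iota2 @^-1` C))) <= r ^+ 2)%R].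
Proof.
move=> PLr.
have /choice [beta_ betaP] k : exists beta,
    dominated_bimeasure (entropy_slope p) (r ^+ 2) (mm_measure X1) (mm_measure X2) beta /\
    forall (e : R) A B A' B', (0 < e)%R ->
    measurable A -> measurable B -> measurable A' -> measurable B' ->
    (r ^+ 2 < k%:R * e * beta A B)%R -> (r ^+ 2 < k%:R * e * beta A' B')%R ->
    exists (x : X1) (y : X2) (x' : X1) (y' : X2),
      [/\ A x, B y, A' x', B' y' & (`|mdist x x' - mdist y y'| <= 2 * e)%R].
  have [Y [psi1 [psi2 [gamma [g1 g2 gc]]]]] := PL_coupling k PLr.
  exists (coupling_bimeasure psi1 psi2 gamma); split.
    exact: coupling_bimeasure_dominated.
  by move=> e A B A' B'; exact: coupling_bimeasure_isometric gc _ _ _ _ _.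
apply: (limit_isometry (entropy_slope_unbounded p1) (beta_ := beta_)).
- by move=> k; have [] := betaP k.
- by move=> k; have [_] := betaP k.
Qed.

End PL_coupling.

(** * Total variation *)

Section hahn.
Context d (T : measurableType d) (R : realType).
Context (mu nu : {finite_measure set T -> \bar R}).

Lemma TV_dist_hahn : exists P N : set T,
  [/\ measurable P, measurable N, P `|` N = setT, P `&` N = set0 &
    [/\ forall A, measurable A -> A `<=` P -> nu A <= mu A,
        forall A, measurable A -> A `<=` N -> mu A <= nu A &
        TV_dist mu nu = (mu P - nu P) + (nu N - mu N)]].
Proof.
pose ch := cadd (charge_of_finite_measure mu)
  (copp (charge_of_finite_measure nu)).
have [P [N [nuPN ->]]] : exists P N (nuPN : hahn_decomposition ch P N),
    TV_dist mu nu = charge_variation nuPN setT.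
  by rewrite /TV_dist /total_variation; eexists _, _, _.
have [[mP posP] [mN negN] PUN PIN] := nuPN.
have chE A : ch A = mu A - nu A by [].
exists P, N; split => //; split.
- move=> A mA AP; have : 0 <= ch A := posP A mA AP.
  by rewrite chE sube_ge0// fin_num_measure.
- move=> A mA AN; have : ch A <= 0 := negN A mA AN.
  by rewrite chE sube_le0// fin_num_measure.
- rewrite /charge_variation /= jordan_posE jordan_negE cjordan_posE cjordan_negE.
  have chargeE A : (ch : {charge set T -> \bar R}) A = mu A - nu A by [].
  rewrite /crestr0 mem_set// /crestr !setTI !chargeE; congr (_ + _).
  by rewrite fin_num_oppeB ?fin_num_measure// addeC.
Qed.

Lemma TV_dist_ge0 : 0 <= TV_dist mu nu.
Proof.
have [P [N [mP mN _ _ [Ple Nle ->]]]] := TV_dist_hahn.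
by apply: adde_ge0; rewrite sube_ge0 ?fin_num_measure//; [exact: Ple|exact: Nle].
Qed.

End hahn.

Section common_part.
Context d (T : measurableType d) (R : realType).
Context (mu nu : {finite_measure set T -> \bar R}) (P N : set T).
Context (mP : measurable P) (mN : measurable N).

(** When [P], [N] is a Hahn decomposition of mu - nu, this is the minimum of the two measures. *)
Definition common_part : set T -> \bar R :=
  measure_add (mrestr mu mN) (mrestr nu mP).

HB.instance Definition _ := Measure.on common_part.

Lemma common_partE A : common_part A = mu (A `&` N) + nu (A `&` P).
Proof. by rewrite /common_part measure_addE. Qed.

Let common_part_fin : fin_num_fun common_part.
Proof.
move=> A mA; rewrite common_partE fin_numD.
by rewrite !fin_num_measure//; exact: measurableI.
Qed.

HB.instance Definition _ :=
  Measure_isFinite.Build _ _ _ common_part common_part_fin.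

End common_part.

(** The density is at most 1 almost everywhere, so U_p(g) <= 1 - g can be integrated. *)
Lemma divergence_le_mass (R : realType) (T : ptopologicalType) (p : R)
    (gamma mu : borel_measure R T) : (1 <= p)%R ->
  (forall A, measurable A -> gamma A <= mu A) ->
  divergence (fun s => (power_entropy p s)%:E) gamma mu <= mu setT - gamma setT.
Proof.
move=> p1 gm_le.
have gm : gamma `<< mu.
  apply/null_content_dominatesP => A mA muA0; apply/eqP.
  by rewrite -measure_le0 -muA0 gm_le.
have [g [mg g0 ig gA ->]] := finite_density gm; last exact: measurable_power_entropy.
pose g' x := Num.min (g x) 1%R.
have mg' : measurable_fun setT g' by exact: measurable_minr.
pose E := [set x | (1 < g x)%R].
have mE : measurable E.
  rewrite -[E]setTI; have -> : E = g @^-1` `]1%R, +oo[%classic.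
    by apply/seteqP; split => x /=; rewrite in_itv /= andbT.
  exact: mg.
have igE : mu.-integrable E (EFin \o g) by exact: integrableS ig.
have icE : mu.-integrable E (EFin \o cst 1%R) by exact: finite_measure_integrable_cst.
(* The integral over [E] of the positive function g - 1 is gamma E - mu E, which is at most 0. *)
have muE : mu E = 0.
  have : ae_eq mu E ((EFin \o g) \- (EFin \o cst 1%R)) (cst 0).
    apply/ae_eq_integral_abs => //.
      by apply: emeasurable_funB; [exact: measurable_int igE|exact: measurable_int icE].
    have -> : \int[mu]_(x in E) `|((EFin \o g) \- (EFin \o cst 1%R)) x| =
        \int[mu]_(x in E) ((EFin \o g) \- (EFin \o cst 1%R)) x.
      apply: eq_integral => x; rewrite inE /E /= => gx.
      by rewrite ger0_norm ?EFinB// subr_ge0 ltW.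
    apply/eqP; rewrite eq_le; apply/andP; split; last first.
      by apply: integral_ge0 => x /= gx; rewrite -EFinB lee_fin subr_ge0 ltW.
    rewrite integralB// -gA//.
    have -> : \int[mu]_(x in E) (EFin \o cst 1%R) x = mu E.
      by rewrite (integral_cst mu mE 1%:E) mul1e.
    by rewrite sube_le0 ?fin_num_measure// gm_le.
  case=> [M [mM muM EM]]; apply/eqP; rewrite -measure_le0 -muM le_measure ?inE// => x Ex.
  apply: EM => /= /(_ Ex) /eqP; rewrite -EFinB eqe subr_eq0 => /eqP gx1.
  by move: Ex; rewrite /E /= gx1 ltxx.
have gg' : ae_eq mu setT g g'.
  exists E; split => // x /= h; apply: contrapT => /negP; rewrite -leNgt => gx.
  by apply: h => _; rewrite /g' min_l.
have -> : \int[mu]_x (power_entropy p (g x))%:E =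
    \int[mu]_x (power_entropy p (g' x))%:E.
  apply: ae_eq_integral => //.
  - apply/measurable_EFinP; apply: (measurableT_comp _ mg).
    exact: measurable_power_entropy.
  - apply/measurable_EFinP; apply: (measurableT_comp _ mg').
    exact: measurable_power_entropy.
  - by apply: filterS gg' => x /= h _; rewrite h.
have -> : mu setT - gamma setT = \int[mu]_x (1 - g' x)%:E.
  rewrite (ae_eq_integral (fun x => 1%:E - (g x)%:E)) //; last 3 first.
  - by apply/measurable_EFinP; exact: measurable_funB.
  - by apply/measurable_EFinP; exact: measurable_funB.
  - by apply: filterS gg' => x /= h _; rewrite -EFinB h.
  rewrite integralB_EFin//; last exact: finite_measure_integrable_cst.
  by rewrite -gA// (integral_cst mu measurableT 1%:E) mul1e.
have g'01 x : (0 <= g' x <= 1)%R by rewrite /g' le_min g0 ler01 ge_min lexx orbT.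
apply: ge0_le_integral => //.
- by move=> x _; rewrite lee_fin power_entropy_ge0//; have /andP[] := g'01 x.
- apply/measurable_EFinP; apply: (measurableT_comp _ mg').
  exact: measurable_power_entropy.
- by apply/measurable_EFinP; exact: measurable_funB.
- by move=> x _; rewrite lee_fin power_entropy_le_id.
Qed.

Section restriction_to_support.
Context {R : realType} {X Y : polishMetricType R} (mu : borel_measure R X).
Context (iota : isometric_embedding X Y).

Lemma support_embedding_isometry (x y : Defs.support mu) :
  mdist (iota (set_val x)) (iota (set_val y)) = mdist x y.
Proof. by rewrite embedding_isometry. Qed.

Definition support_embedding : isometric_embedding (Defs.support mu) Y :=
  IsometricEmbedding support_embedding_isometry.

(** The two image measures agree only on Borel sets; hence the primed copies of the measures in
    [entropy_transport_le_TV]. *)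
Lemma spushforward_support_embedding (B : set (borel Y)) : measurable B ->
  spushforward support_embedding B =
  cpushforward (@embedding_continuous _ _ _ iota) mu B.
Proof.
move=> mB; rewrite /spushforward /= /cpushforward /pushforward.
rewrite -[RHS]measureI_support; last first.
  exact: (preimage_borel (@embedding_continuous _ _ _ iota) mB).
congr (mu _); apply/seteqP; split => [_ [x Bx <-]|x [Bx sx]].
  by split => //; exact: set_valP.
by exists (exist _ x (mem_set sx)).
Qed.

End restriction_to_support.

Lemma diagonal_continuous (T : topologicalType) : continuous (fun x : T => (x, x)).
Proof. by move=> x; apply: cvg_pair. Qed.

(* The coupling is the diagonal one with common marginal the minimum of the two
   measures, so that nothing is transported. *)
Lemma entropy_transport_le_TV (R : realType) (p : R) (n : nat) (Y : polishMetricType R)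
    (mu nu mu' nu' : borel_measure R Y) : (1 <= p)%R ->
  (forall A, measurable A -> mu' A = mu A) ->
  (forall A, measurable A -> nu' A = nu A) ->
  entropy_transport (fun s => (power_entropy p s)%:E)
    (fun z => (n%:R * mdist z.1 z.2)%:E) mu' nu' <= TV_dist mu nu.
Proof.
move=> p1 mu'E nu'E; have [P [N [mP mN PUN PIN [Ple Nle ->]]]] := TV_dist_hahn mu nu.
have splitPN (m : borel_measure R Y) (A : set (borel Y)) : measurable A ->
    m A = m (A `&` N) + m (A `&` P).
  move=> mA; rewrite -measureU; try exact: measurableI.
    by rewrite -setIUr setUC PUN setIT.
  by rewrite setIACA (setIC N) PIN setI0.
have fE (m : borel_measure R Y) A : measurable A -> m A = (fine (m A))%:E.
  by move=> mA; rewrite fineK// fin_num_measure.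
pose sigma : borel_measure R Y := common_part mu nu mP mN.
have sigmaE A : sigma A = mu (A `&` N) + nu (A `&` P) by exact: common_partE.
have sigma_mu A : measurable A -> sigma A <= mu' A.
  move=> mA; rewrite mu'E// (splitPN mu A mA) sigmaE leeD2l//.
  by apply: Ple; [exact: measurableI|exact: subIsetr].
have sigma_nu A : measurable A -> sigma A <= nu' A.
  move=> mA; rewrite nu'E// (splitPN nu A mA) sigmaE leeD2r//.
  by apply: Nle; [exact: measurableI|exact: subIsetr].
apply: ge_ereal_inf; eexists.
  by exists (cpushforward (@diagonal_continuous Y) sigma).
set gamma := cpushforward (@diagonal_continuous Y) sigma.
have -> : \int[gamma]_z (n%:R * mdist z.1 z.2)%:E = 0.
  have mc : measurable_fun [set: borel (Y * Y)%type]
      (fun z : borel (Y * Y)%type => (n%:R * mdist z.1 z.2)%:E).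
    apply/measurable_EFinP; apply: measurable_funM => //; exact: measurable_mdist.
  rewrite (ge0_integral_pushforward
    (continuous_borel (@diagonal_continuous Y)) _ measurableT mc); last first.
    by move=> z _; rewrite lee_fin mulr_ge0// mdist_ge0.
  by apply: integral0_eq => x _ /=; rewrite mdistxx mulr0.
(* The mass missing from [sigma] is mu P - nu P on one side and nu N - mu N on the other: together,
   the total variation. *)
rewrite adde0; apply: leeD.
  apply: le_trans (divergence_le_mass p1 _) _; first exact: sigma_mu.
  change (mu' setT - sigma setT <= mu P - nu P).
  rewrite sigmaE mu'E// !setTI (splitPN mu _ measurableT) !setTI.
  by rewrite (fE mu N)// (fE mu P)// (fE nu P)// lee_fin; lra.
apply: le_trans (divergence_le_mass p1 _) _; first exact: sigma_nu.
change (nu' setT - sigma setT <= nu N - mu N).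
rewrite sigmaE nu'E// !setTI (splitPN nu _ measurableT) !setTI.
by rewrite (fE nu N)// (fE mu N)// (fE nu P)// lee_fin; lra.
Qed.

Lemma mm_ET_dist_le_TV (R : realType) (p : R) (n : nat) (X1 X2 : mmspace R)
    (Y : polishMetricType R) (iota1 : isometric_embedding X1 Y)
    (iota2 : isometric_embedding X2 Y) : (1 <= p)%R ->
  mm_ET_dist p n X1 X2 <=
  sqrte (TV_dist (cpushforward (@embedding_continuous _ _ _ iota1) (mm_measure X1))
                 (cpushforward (@embedding_continuous _ _ _ iota2) (mm_measure X2))).
Proof.
move=> p1; apply: ge_ereal_inf; eexists.
  by exists Y, (support_embedding (mm_measure X1) iota1),
    (support_embedding (mm_measure X2) iota2).
rewrite /ET_dist lee_sqrt ?TV_dist_ge0//.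
by apply: entropy_transport_le_TV => // A mA;
  exact: spushforward_support_embedding.
Qed.

(** * The two implications *)

Lemma cvge0P (R : realType) (u : nat -> \bar R) : (forall n, 0 <= u n) ->
  u @ \oo --> 0 <->
  forall e : R, (0 < e)%R -> exists N, forall n, (N <= n)%N -> u n < e%:E.
Proof.
move=> u0; split=> [u_cvg e e0|h].
  have [ufin /cvgrPdist_lt /(_ e e0) uD] := (fine_cvgP _ _).1 u_cvg.
  have [N _ NP] := filterI ufin uD; exists N => n /NP [/= un].
  by rewrite sub0r normrN -{2}(fineK un) lte_fin; apply: le_lt_trans; exact: ler_norm.
apply/fine_cvgP; split.
  have [N NP] := h _ (@ltr01 R); exists N => // n /= /NP un1.
  by rewrite ge0_fin_numE// (lt_trans un1)// ltry.
apply/cvgrPdist_lt => e e0; have [N NP] := h e e0; exists N => // n /= /NP un.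
have unf : u n \is a fin_num by rewrite ge0_fin_numE// (lt_trans un)// ltry.
by rewrite sub0r normrN ger0_norm ?fine_ge0// -lte_fin fineK.
Qed.

Local Close Scope ereal_scope.

(** The tangents at 1 + h and 1 - h place [v] between (1 - h) z - eta and (1 + h) z + eta for z = x
    and z = y. Only [y] appears in the bound: [x] will be a mass in [X n], not bounded in
    advance. *)
Lemma tangent_bounds_close (R : realType) (s1 s2 delta h eta x y v : R) :
  0 < h -> h <= 1 / 2 -> 0 <= eta -> 0 <= x -> 0 <= y -> 0 < s1 -> s2 < 0 ->
  delta <= eta * s1 -> delta <= eta * - s2 ->
  s1 * (v - (1 + h) * x) <= delta -> s2 * (v - (1 - h) * x) <= delta ->
  s1 * (v - (1 + h) * y) <= delta -> s2 * (v - (1 - h) * y) <= delta ->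
  `|x - y| <= 4 * h * y + 4 * eta.
Proof.
move=> h0 h2 eta0 x0 y0 s10 s20 d1 d2 x1 x2 y1 y2.
have up z : s1 * (v - (1 + h) * z) <= delta -> v - (1 + h) * z <= eta.
  by move=> /le_trans /(_ d1); rewrite mulrC ler_pM2r.
have low z : s2 * (v - (1 - h) * z) <= delta -> (1 - h) * z - v <= eta.
  have s20' : 0 < - s2 by rewrite oppr_gt0.
  by move=> /le_trans /(_ d2); rewrite -mulrNN mulrC ler_pM2r// opprB.
have {x1}xu := up _ x1; have {x2}xl := low _ x2.
have {y1}yu := up _ y1; have {y2}yl := low _ y2.
have hx : h * x <= 1 / 2 * x by rewrite ler_wpM2r.
have hy : h * y <= 1 / 2 * y by rewrite ler_wpM2r.
(* A crude bound from h <= 1 / 2, used to eliminate the product h * x. *)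
have xy : x <= 3 * y + 4 * eta by lra.
have hxy : h * x <= h * (3 * y + 4 * eta) by rewrite ler_wpM2l// ltW.
have heta : h * eta <= 1 / 2 * eta by rewrite ler_wpM2r.
by rewrite ler_norml; apply/andP; split; lra.
Qed.

Lemma strong_mG_cvg_PL (R : realType) (p : R) (X : nat -> mmspace R)
    (Xoo : mmspace R) : 1 <= p ->
  strong_mG_cvg X Xoo -> PL p (X n) Xoo @[n --> \oo] --> 0%E.
Proof.
move=> p1 [Y [iota [iotaoo TV0]]].
apply/cvge0P => [n|e e0]; first exact: PL_ge0.
(* PL is at most the square root of the total variation; e / 2 restores the strict inequality lost
   in the supremum over k. *)
have e20 : 0 < (e / 2) ^+ 2 by rewrite exprn_gt0// divr_gt0.
have [N NP] := (cvge0P (fun n => TV_dist_ge0 _ _)).1 TV0 _ e20.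
exists N => n /NP TVn.
apply: (@le_lt_trans _ _ (e / 2)%:E); last by rewrite lte_fin; lra.
have := ereal_nondecreasing_cvgn (mm_ET_dist_nondecreasing p1 (X n) Xoo).
rewrite /PL => /cvg_lim ->//; apply: ge_ereal_sup => _ [k _ <-].
apply: le_trans (mm_ET_dist_le_TV k (iota n) iotaoo p1) _.
have -> : (e / 2)%:E = sqrte ((e / 2) ^+ 2)%:E.
  by rewrite /= sqrtr_sqr ger0_norm// divr_ge0// ltW.
by rewrite lee_sqrt ?lee_fin ltW.
Qed.

Lemma PL_strong_mG_cvg (R : realType) (p : R) (X : nat -> mmspace R)
    (Xoo : mmspace R) : 1 <= p ->
  PL p (X n) Xoo @[n --> \oo] --> 0%E -> strong_mG_cvg X Xoo.
Proof.
move=> p1 /(cvge0P (fun n => PL_ge0 p1 _ _)) PL0.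
(* The added term gives the strict inequality that [PL_isometry] needs. The bound depends on [n]
   alone, since all relations are chosen before the gluing, hence before any [e]. *)
pose r n := fine (PL p (X n) Xoo) + n.+1%:R^-1.
pose good n (rel : X n -> Xoo -> Prop) :=
  [/\ exists x y, rel x y,
      forall x y x' y', rel x y -> rel x' y' -> mdist x x' = mdist y y' &
      (PL p (X n) Xoo < +oo)%E ->
      forall (Y : polishMetricType R) (iota1 : isometric_embedding (X n) Y)
        (iota2 : isometric_embedding Xoo Y),
      (forall x y, rel x y -> iota1 x = iota2 y) ->
      forall C : set (borel Y), measurable C ->
      exists v, forall a, 0 < a ->
        entropy_slope p a *
          (v - a * fine (mm_measure (X n) (iota1 @^-1` C))) <= r n ^+ 2 /\
        entropy_slope p a *
          (v - a * fine (mm_measure Xoo (iota2 @^-1` C))) <= r n ^+ 2].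
have good_ex n : exists rel, good n rel.
  have [PLoo|PLoo] := pselect (PL p (X n) Xoo < +oo)%E; last first.
    (* Finitely many [X n] may be at infinite PL distance; they still have to be glued, here at one
       point. *)
    exists (fun x y => x = point /\ y = point); split => //.
      by exists point, point.
    by move=> x y x' y' [-> ->] [-> ->]; rewrite !mdistxx.
  have [|rel [rel0 reliso relP]] := @PL_isometry R p p1 (X n) Xoo (r n).
    rewrite /r EFinD fineK; last by rewrite ge0_fin_numE// PL_ge0.
    by rewrite lteDl ?ge0_fin_numE ?PL_ge0// lte_fin invr_gt0.
  by exists rel.
pose rel n := sval (cid (good_ex n)).
have relP n : good n (rel n) := svalP (cid (good_ex n)).
have [||Y [iota [iotaoo agree]]] := @star_amalgam R X Xoo rel.
- by move=> n; have [] := relP n.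
- by move=> n; have [] := relP n.
exists Y, iota, iotaoo; apply/cvge0P => [n|e e0]; first exact: TV_dist_ge0.
pose M := fine (mm_measure Xoo setT).
have M0 : 0 <= M by exact: fine_ge0.
(* With eta = e / 32 below, 4 h M + 4 eta <= e / 4 for each Borel set, so the two Hahn sets give at
   most e / 2. *)
pose h := Num.min (1 / 2) (e / (32 * (M + 1))).
have h0 : 0 < h by rewrite lt_min !divr_gt0// mulr_gt0//; lra.
have h2 : h <= 1 / 2 by rewrite /h ge_min lexx.
have hM : h * M <= e / 32.
  apply: (@le_trans _ _ (e / (32 * (M + 1)) * M)).
    by rewrite ler_wpM2r// ge_min lexx orbT.
  rewrite mulrAC ler_pdivrMr; last by rewrite mulr_gt0//; lra.
  have : 0 <= e by lra.
  nra.
pose eta := e / 32.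
have eta0 : 0 < eta by rewrite divr_gt0.
have s1 : 0 < entropy_slope p (1 + h) by apply: entropy_slope_gt0 => //; lra.
have s2 : entropy_slope p (1 - h) < 0.
  by apply: entropy_slope_lt0 => //; apply/andP; split; lra.
(* The 1 gives r^2 <= r; the other two give the hypotheses of [tangent_bounds_close] on [delta],
   here r^2. *)
pose kappa := Num.min (Num.min 1 (eta * entropy_slope p (1 + h)))
  (eta * - entropy_slope p (1 - h)).
have k0 : 0 < kappa.
  by rewrite !lt_min ltr01 /= !mulr_gt0// oppr_gt0.
have k20 : 0 < kappa / 2 by rewrite divr_gt0.
have [N1 N1P] := PL0 _ k20; have [N2 N2P] := natSinv_lt k20.
exists (maxn N1 N2) => n; rewrite geq_max => /andP[/N1P PLn /N2P nn].
have PLoo : (PL p (X n) Xoo < +oo)%E by rewrite (lt_trans PLn)// ltry.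
have PLfin : PL p (X n) Xoo \is a fin_num by rewrite ge0_fin_numE// PL_ge0.
have r0 : 0 <= r n by rewrite addr_ge0// fine_ge0// PL_ge0.
have rk : r n <= kappa.
  have : fine (PL p (X n) Xoo) < kappa / 2 by rewrite -lte_fin fineK.
  by move: nn; rewrite /r; set q := n.+1%:R^-1; lra.
have [rk1 [rk2 rk3]] : r n <= 1 /\ r n <= eta * entropy_slope p (1 + h) /\
    r n <= eta * - entropy_slope p (1 - h).
  by move: rk; rewrite !le_min => /andP[/andP[-> ->] ->].
have r2 : r n ^+ 2 <= r n by rewrite expr2 ler_piMr.
have [_ _ /(_ PLoo Y (iota n) iotaoo (agree n)) bound] := relP n.
set mu := cpushforward _ (mm_measure (X n)); set nu := cpushforward _ (mm_measure Xoo).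
have close (C : set (borel Y)) : measurable C ->
    `|fine (mu C) - fine (nu C)| <= e / 4.
  move=> mC; have [v vP] := bound C mC.
  have [x1 y1] := vP (1 + h) (ltac:(lra)).
  have [x2 y2] := vP (1 - h) (ltac:(lra)).
  have muC0 : 0 <= fine (mu C) by rewrite fine_ge0// measure_ge0.
  have nuC0 : 0 <= fine (nu C) by rewrite fine_ge0// measure_ge0.
  have nuM : fine (nu C) <= M.
    rewrite /M fine_le ?fin_num_measure// /nu.
    have -> : mm_measure Xoo setT =
        cpushforward (@embedding_continuous _ _ _ iotaoo) (mm_measure Xoo) setT by [].
    by apply: le_measure; rewrite ?inE.
  apply: (le_trans (tangent_bounds_close h0 h2 (ltW eta0) muC0 nuC0 s1 s2
    _ _ x1 x2 y1 y2)).
  - exact: le_trans r2 rk2.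
  - exact: le_trans r2 rk3.
  - rewrite /eta; nra.
have [P [N [mP mN _ _ [_ _ ->]]]] := TV_dist_hahn mu nu.
have fE (m : borel_measure R Y) A : measurable A -> m A = (fine (m A))%:E.
  by move=> mA; rewrite fineK// fin_num_measure.
have := close P mP; have := close N mN; rewrite !ler_norml => /andP[? ?] /andP[? ?].
rewrite (fE mu P)// (fE nu P)// (fE mu N)// (fE nu N)// lte_fin; lra.
Qed.

Theorem theorem6 (R : realType) (p : R) (hp : 1 <= p)
    (X : nat -> mmspace R) (Xoo : mmspace R) :
  strong_mG_cvg X Xoo <-> PL p (X n) Xoo @[n --> \oo] --> 0%E.
Proof.
by split; [exact: strong_mG_cvg_PL|exact: PL_strong_mG_cvg].
Qed.
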